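(* Let $p\ge1$ be an integer. For every constant $\epsilon>0$ there exists a (possibly randomized) algorithm for the submodular random order streaming problem with $p$-matchoid constraints which, on every instance with $n$ items, a $p$-matchoid given by matroids $\mathcal{M}_1,\dots,\mathcal{M}_q$ whose largest feasible set has size $k$, and a monotone submodular function $f$, achieves a $$\frac{1}{p+1}\left(1-\frac{1}{e^{p+1}}-\epsilon-O\!\left(\frac1k\right)\right)$$ approximation to $\mathrm{OPT}$ while using a memory buffer of size at most $\eta_\epsilon(k)=O(k)$. Moreover, the number of objective function evaluations for each item, amortized over the $n$ items, is $O\!\left(p\kappa+\kappa^p+\frac{k^2}{n}\right)$, where $\kappa=\max_{i\in[q]} rk(\mathcal{M}_i)$.
   Context: $p$-matchoid. Let $\mathcal{M}_1=(\mathcal{N}_1,\mathcal{I}_1),\dots,\mathcal{M}_q=(\mathcal{N}_q,\mathcal{I}_q)$ be matroids over (possibly overlapping) ground sets. Let $\mathcal{N}=\mathcal{N}_1\cup\dots\cup\mathcal{N}_q$ and $\mathcal{I}=\{S\subseteq\mathcal{N}: S\cap\mathcal{N}_\ell\in\mathcal{I}_\ell\ \text{for all }\ell\in[q]\}$. The set system $(\mathcal{N},\mathcal{I})$ is a $p$-matchoid if every $e\in\mathcal{N}$ belongs to $\mathcal{N}_\ell$ for at most $p$ indices $\ell\in[q]$. Sets in $\mathcal{I}$ are called feasible, and $k$ denotes the size of the largest feasible set. Submodular random order streaming problem with $p$-matchoid constraints. An instance consists of a $p$-matchoid $(\mathcal{N},\mathcal{I})$ with $|\mathcal{N}|=n$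 and a monotone submodular function $f:2^{\mathcal{N}}\to\mathbb{R}_{\ge0}$. The items of $\mathcal{N}$ arrive one at a time in a single pass in uniformly random order; $n$ and $k$ are known, but the set of items is not. The algorithm may keep previously seen items in a memory buffer; items in the buffer may be discarded and replaced by newly arriving ones, but an item not in the buffer is lost. A memory buffer of size $\eta(k)$ means that at most $\eta(k)$ items are stored at any time. The algorithm has value oracle access to $f$ and independence oracle access to the matroids (on sets of items available to it). At the end it outputs a set $S\in\mathcal{I}$ of items from the buffer. It achieves a $c$ approximation if $\mathbb{E}[f(S)]\ge c\cdot\mathrm{OPT}$, where $\mathrm{OPT}=\max_{S\in\mathcal{I}}f(S)$ and the expectation is over the arrival order and internal randomness. ''Amortized over the $n$ items'' means the total number of evaluations of $f$ divided by $n$. $O(\cdot)$ is asymptotic in $n$, $k$, $\kappa$, with $\epsilon$ and $p$ regarded as constants. *)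

(* Defs.v *)
From HB Require Import structures.
From mathcomp Require Import all_boot all_order all_algebra.
From mathcomp Require Import reals.

Set Implicit Arguments.
Unset Strict Implicit.
Unset Printing Implicit Defensive.

Import Order.TTheory GRing.Theory Num.Theory.
Local Open Scope ring_scope.

Record matroid (T : finType) := Matroid {
  ground : {set T};
  indep : {set {set T}};
  indep_ground : forall A, A \in indep -> A \subset ground;
  indep0 : set0 \in indep;
  indep_sub : forall A B : {set T}, A \subset B -> B \in indep -> A \in indep;
  indep_aug : forall A B : {set T}, A \in indep -> B \in indep ->
    (#|A| < #|B|)%N -> exists2 x, x \in B :\: A & x |: A \in indep }.

Definition rk (T : finType) (M : matroid T) : nat :=
  (\max_(A in indep M) #|A|)%N.

(* The type [T] plays the role of the union of the ground sets. *)
Definition is_matchoid (p : nat) (T : finType) (q : nat)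
    (M : 'I_q -> matroid T) : Prop :=
  \bigcup_l ground (M l) = [set: T] /\
  forall e : T, (#|[set l | e \in ground (M l)]| <= p)%N.

Definition feasible (T : finType) (q : nat) (M : 'I_q -> matroid T) :
    {set {set T}} :=
  [set S | [forall l, S :&: ground (M l) \in indep (M l)]].

Definition max_feasible_size (T : finType) (q : nat) (M : 'I_q -> matroid T) :
    nat := (\max_(S in feasible M) #|S|)%N.

Definition max_rk (T : finType) (q : nat) (M : 'I_q -> matroid T) : nat :=
  (\max_(l < q) rk (M l))%N.

(* Used for nonnegative [f] only, whence the default value [0]. *)
Definition OPT (R : realType) (T : finType) (q : nat) (M : 'I_q -> matroid T)
    (f : {set T} -> R) : R :=
  \big[Num.max/0]_(S in feasible M) f S.

Definition nonnegative (R : realType) (T : finType) (f : {set T} -> R) : Prop :=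
  forall A, 0 <= f A.

Definition monotone (R : realType) (T : finType) (f : {set T} -> R) : Prop :=
  forall A B : {set T}, A \subset B -> f A <= f B.

Definition submodular (R : realType) (T : finType) (f : {set T} -> R) : Prop :=
  forall A B : {set T}, f (A :|: B) + f (A :&: B) <= f A + f B.

(* A streaming algorithm is an interaction tree.  It never sees the items
   themselves: the item that arrives in position [i] (counted from 0) is
   referred to by the handle [i : 'I_n], so that nothing is known about an item
   beyond the answers of the oracles.  Internal memory other than the buffer of
   items is unrestricted and is implicit in the continuations.
   - [Output A] stops and returns [A];
   - [Draw m c] draws an element of ['I_m.+1] uniformly and independently of
     everything else;
   - [Eval A c] makes one evaluation of the objective function;
   - [Indep l A c] makes one query to the independence oracle of the l-th
     matroid;
   - [Discard D c] removes [D] from the buffer;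
   - [Read c] puts the next item of the stream into the buffer. *)
Inductive stream_alg (R : realType) (n q : nat) : Type :=
| Output of {set 'I_n}
| Draw (m : nat) of 'I_m.+1 -> stream_alg R n q
| Eval of {set 'I_n} & (R -> stream_alg R n q)
| Indep of 'I_q & {set 'I_n} & (bool -> stream_alg R n q)
| Discard of {set 'I_n} & stream_alg R n q
| Read of stream_alg R n q.

Arguments Output {R n q} _.
Arguments Draw {R n q} m _.
Arguments Eval {R n q} _ _.
Arguments Indep {R n q} _ _ _.
Arguments Discard {R n q} _ _.
Arguments Read {R n q} _.

Section Semantics.
Variables (R : realType) (n q : nat) (T : finType).
Variables (M : 'I_q -> matroid T) (f : {set T} -> R).

(* Arrival orders; they are bijections as soon as [#|T| = n]. *)
Definition arrival_orders : {set {ffun 'I_n -> T}} :=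
  [set s : {ffun 'I_n -> T} | injectiveb s].

Variable s : {ffun 'I_n -> T}.

Definition items (A : {set 'I_n}) : {set T} := [set s i | i in A].

(* The l-th oracle accepts any set of available items, not just subsets of the
   l-th ground set, and tests the part of it inside that ground set. *)
Definition indep_answer (l : 'I_q) (A : {set 'I_n}) : bool :=
  items A :&: ground (M l) \in indep (M l).

(* When [t] items have arrived and [B] is the set of items in the buffer, every
   continuation of the run, whatever the outcomes of the draws, queries the
   oracles on subsets of the buffer only, never stores more than [cap] items
   (the item being processed included), reads at most [n] items in total, and
   outputs a feasible subset of the buffer. *)
Fixpoint legal (cap t : nat) (B : {set 'I_n}) (P : stream_alg R n q) : Prop :=
  match P with
  | Output A => A \subset B /\ items A \in feasible M
  | Draw m c => forall i : 'I_m.+1, legal cap t B (c i)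
  | Eval A c => A \subset B /\ legal cap t B (c (f (items A)))
  | Indep l A c => A \subset B /\ legal cap t B (c (indep_answer l A))
  | Discard D c => legal cap t (B :\: D) c
  | Read c =>
      let B' := B :|: [set i : 'I_n | val i == t] in
      [/\ (t < n)%N, (#|B'| <= cap)%N & legal cap t.+1 B' c]
  end.

(* Largest number of evaluations of [f] over all outcomes of the draws. *)
Fixpoint evals (P : stream_alg R n q) : nat :=
  match P with
  | Output _ => 0%N
  | Draw m c => (\max_(i < m.+1) evals (c i))%N
  | Eval A c => (evals (c (f (items A)))).+1
  | Indep l A c => evals (c (indep_answer l A))
  | Discard _ c => evals c
  | Read c => evals c
  end.

(* Expectation of [f] at the output, over the draws. *)
Fixpoint draw_expectation (P : stream_alg R n q) : R :=
  match P with
  | Output A => f (items A)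
  | Draw m c => (\sum_(i < m.+1) draw_expectation (c i)) / m.+1%:R
  | Eval A c => draw_expectation (c (f (items A)))
  | Indep l A c => draw_expectation (c (indep_answer l A))
  | Discard _ c => draw_expectation c
  | Read c => draw_expectation c
  end.

End Semantics.

Definition expected_value (R : realType) (n q : nat) (T : finType)
    (M : 'I_q -> matroid T) (f : {set T} -> R) (P : stream_alg R n q) : R :=
  (\sum_(s in arrival_orders n T) draw_expectation M f s P)
    / #|arrival_orders n T|%:R.

(* Main.v *)
(* Every item is labelled with a uniformly random window among m = alpha k, and
   with one coin of bias 1/m per window.  In window i the candidates are the items
   arriving there and the previously picked items whose coin comes up; the best
   feasible swap of a candidate into the current solution S, evicting at most one
   element per violated matroid, is performed if it improves f.  All the items
   ever picked stay in the buffer, whence its size m + O(1).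

   Given the outcomes of the windows before i, the labels of distinct items remain
   independent, and every item is a candidate in window i with probability at
   least 1/m.  So with probability about 1/alpha a window contains an essentially
   uniform element of the optimum O.  By exchange in each matroid the gains of
   swapping in the elements of O sum to at least f(O) - (p + 1) f(S), so that
   f(O) - (p + 1) E f(S) shrinks in each window by a factor of
   1 - (p + 1)(1 - 1/alpha)/m.

   The evaluations caused by the coins number n kappa^p in expectation; to bound
   them in the worst case the algorithm gives up when too many coins come up,
   which by Markov's inequality costs only a small fraction of the optimum. *)
Require Import Defs.
From HB Require Import structures.
From mathcomp Require Import all_boot all_order all_algebra.
From mathcomp Require Import reals sequences exp.
From mathcomp Require Import zify ring lra.

Set Implicit Arguments.
Unset Strict Implicit.
Unset Printing Implicit Defensive.

Import Order.TTheory GRing.Theory Num.Theory.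
Local Open Scope ring_scope.

(** * Exchange between two independent sets of a matroid *)

Section MatroidExchange.
Variables (T : finType) (M : matroid T).
Implicit Types A B : {set T}.

Lemma indep_extend A B : A \in indep M -> B \in indep M ->
  exists W, [/\ W \in indep M, A \subset W, W \subset A :|: B & (#|B| <= #|W|)%N].
Proof.
move=> iA iB; have [k] := ubnP (#|B| - #|A|)%N.
elim: k A iA => // k IH A iA lek.
have [leBA|ltAB] := leqP #|B| #|A|; first by exists A; split=> //; exact: subsetUl.
have [x /setDP[xB xA] iW] := indep_aug iA iB ltAB.
have cW : #|x |: A| = #|A|.+1 by rewrite cardsU1 xA.
have [|W [iW' sW1 sW2 cWW]] := IH _ iW.
  by rewrite cW subnS prednK ?subn_gt0.
exists W; split=> //; first exact: subset_trans (subsetUr _ _) sW1.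
apply: subset_trans sW2 _; rewrite -setUA subUset subxx andbT sub1set.
by rewrite inE xB orbT.
Qed.

(** Together with [b], the minimal [Z] is the fundamental circuit of [b] in [A]. Extending [Z] from
    [B] gives a [Y] without [b] at least as large as [B], so some [a] of [Y] augments [B :\ b]; it
    lies in [Z]. By minimality [b |: Z :\ a] is independent, and extending it from [A] can only give
    [b |: A :\ a]. *)
Lemma symmetric_exchange A B b : A \in indep M -> B \in indep M ->
  b \in B -> b |: A \notin indep M ->
  exists a, [/\ a \in A, a \notin B, b |: A :\ a \in indep M
              & a |: B :\ b \in indep M].
Proof.
move=> iA iB bB nA.
have [Z /minsetP[/andP[sZA nZ] minZ]] :
    {Z | minset [pred Z : {set T} | (Z \subset A) && (b |: Z \notin indep M)] Z}.
  have [|Z] := @minset_exists _ [pred Z : {set T} | (Z \subset A) &&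
    (b |: Z \notin indep M)] A; first by rewrite /= subxx.
  by move=> mZ _; exists Z.
have iZ := indep_sub sZA iA.
have bnA : b \notin A by apply: contra nA => bA; rewrite setUC (setUidPl _) ?sub1set.
have [Y [iY sZY sYZB cY]] := indep_extend iZ iB.
have bnY : b \notin Y.
  by apply: contra nZ => bY; apply: indep_sub iY; rewrite subUset sub1set bY.
have iBb : B :\ b \in indep M by apply: indep_sub iB; exact: subsetDl.
have [|a /setDP[aY]] := indep_aug iBb iY.
  by apply: leq_trans cY; rewrite (cardsD1 b B) bB.
have anb : a != b by apply: contraNneq bnY => <-.
rewrite !inE anb /= => anB iaB.
have aZ : a \in Z by have := subsetP sYZB _ aY; rewrite inE (negPf anB) orbF.
exists a; split=> //; first exact: (subsetP sZA).
have iZa : b |: Z :\ a \in indep M.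
  apply/negPn/negP => nZa.
  have := minZ (Z :\ a); rewrite /= nZa (subset_trans (subsetDl _ _) sZA) subsetDl.
  by move=> /(_ isT isT) E; move: aZ; rewrite -E !inE eqxx.
have [W [iW sW1 sW2 cW]] := indep_extend iZa iA.
have bW : b \in W by apply: (subsetP sW1); rewrite setU11.
have anW : a \notin W.
  apply: contra nZ => aW; apply: indep_sub iW; rewrite subUset sub1set bW /=.
  apply/subsetP=> z zZ; have [->//|zna] := eqVneq z a.
  by apply: (subsetP sW1); rewrite !inE zna zZ orbT.
have sW : W \subset b |: A :\ a.
  apply/subsetP=> z zW; have := subsetP sW2 z zW; rewrite !inE.
  have zna : z != a by apply: contraNneq anW => <-.
  rewrite zna /=; case: eqP => //= _ /orP[/(subsetP sZA)//|//].
suff <- : W = b |: A :\ a by [].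
apply/eqP; rewrite eqEcard sW /=; apply: leq_trans cW.
rewrite cardsU1 (cardsD1 a A) (subsetP sZA _ aZ) leq_add2r.
by case: (_ \notin _).
Qed.

(** Induction on the number of elements of [B] that [A] blocks: one symmetric exchange replaces [b]
    in [B] by an element [a] of [A], which removes [b] from the blocked elements and adds none. *)
Lemma exchange_injection A B : A \in indep M -> B \in indep M ->
  exists phi : T -> T, forall b, b \in B -> b |: A \notin indep M ->
    [/\ phi b \in A, b |: A :\ phi b \in indep M
      & forall c, c \in B -> c |: A \notin indep M -> phi c = phi b -> c = b].
Proof.
move=> iA iB.
pose V B := [set b in B | b |: A \notin indep M].
(* Images are also kept outside [B]: for the exchanged set [a |: B :\ b] this means that no other
   image is [a], which preserves injectivity. *)
suff: exists phi : T -> T, forall b, b \in V B ->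
    [/\ phi b \in A :\: B, b |: A :\ phi b \in indep M
      & forall c, c \in V B -> phi c = phi b -> c = b].
  move=> [phi H]; exists phi => b bB bA.
  have bV : b \in V B by rewrite inE bB.
  have [/setDP[h1 _] h2 h3] := H _ bV; split=> // c cB cA.
  by apply: h3; rewrite inE cB.
have [k] := ubnP #|V B|; elim: k B iB => // k IH B iB lek.
have [->|[b bV]] := set_0Vmem (V B).
  by exists id => b; rewrite inE.
have /[!inE]/andP[bB bA] := bV.
have [a [aA anB iAa iBb]] := symmetric_exchange iA iB bB bA.
have VE : V (a |: B :\ b) = V B :\ b.
  apply/setP=> z; rewrite !inE; have [->|zna] := eqVneq z a.
    by rewrite setUC (setUidPl _) ?sub1set // iA (negPf anB) !andbF.
  by rewrite /= andbA.
have [|phi H] := IH _ iBb; first by rewrite VE; move: lek; rewrite (cardsD1 b) bV.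
exists (fun z => if z == b then a else phi z) => z zV.
have [->|znb] := eqVneq z b.
  split=> //; first by rewrite inE anB.
  move=> c cV; case: eqP => // /eqP cnb E.
  have [|+ _ _] := H c; first by rewrite VE !inE cnb; rewrite inE in cV.
  by rewrite E !inE eqxx.
have zV' : z \in V (a |: B :\ b) by rewrite VE in_setD1 znb zV.
have [+ h2 h3] := H _ zV'; rewrite !inE negb_or => /andP[/andP[pa h1] pA].
split=> //.
  rewrite pA andbT; apply: contra h1 => ->; rewrite andbT.
  apply: contraTneq pA => ->; apply: contra bA => bA.
  by rewrite setUC (setUidPl _) ?sub1set.
move=> c cV; case: eqP => [cb aE|/eqP cnb]; first by rewrite -aE eqxx in pa.
by apply: h3; rewrite VE in_setD1 cnb cV.
Qed.

End MatroidExchange.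

(** * Marginal gains and losses of a submodular function *)

Section Submodular.
Variables (R : realType) (T : finType) (f : {set T} -> R).
Hypotheses (f_mono : monotone f) (f_sub : submodular f).

Lemma marginal_sum_ge (S : {set T}) (r : seq T) :
  f (S :|: [set x in r]) - f S <= \sum_(x <- r) (f (x |: S) - f S).
Proof.
elim: r => [|x r IH]; first by rewrite big_nil set_nil setU0 subrr.
rewrite big_cons set_cons.
have := f_sub (x |: S) (S :|: [set x in r]).
have -> : (x |: S) :|: (S :|: [set x in r]) = S :|: (x |: [set x in r]).
  by apply/setP=> z; rewrite !inE; do !case: (_ == _); do !case: (_ \in _).
have : f S <= f ((x |: S) :&: (S :|: [set x in r])).
  by apply: f_mono; rewrite subsetI subsetUr subsetUl.
by move: IH; lra.
Qed.

(** Delete the elements of [S] one by one. The drop of [f] at [z] is charged to the at most [p] sets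
    [D i] that contain [z]; for the others submodularity bounds the loss by the one over [S :\ z].
    The drops telescope to [f S - f set0]. *)
Lemma removal_sum_le (I : finType) (P : {set I}) (D : I -> {set T}) (p : nat)
    (S : {set T}) :
  (forall z, z \in S -> (#|[set i in P | z \in D i]| <= p)%N) ->
  \sum_(i in P) (f S - f (S :\: D i)) <= p%:R * (f S - f set0).
Proof.
have [k] := ubnP #|S|; elim: k S => // k IH S lek Hp.
have [S0|[z zS]] := set_0Vmem S.
  rewrite S0 subrr mulr0 big1 // => i _.
  by rewrite set0D subrr.
have cS : (#|S :\ z| < k)%N by move: lek; rewrite (cardsD1 z) zS.
have Hp' y : y \in S :\ z -> (#|[set i in P | y \in D i]| <= p)%N.
  by move=> /setD1P[_ /Hp].
have {IH} := IH _ cS Hp'.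
have mz : f (S :\ z) <= f S by apply: f_mono; exact: subsetDl.
have : \sum_(i in P) (f S - f (S :\: D i)) <=
   \sum_(i in P) (f (S :\ z) - f (S :\ z :\: D i)) +
   \sum_(i in P) (if z \in D i then f S - f (S :\ z) else 0).
  rewrite -big_split /=; apply: ler_sum => i _.
  have [zD|zD] := boolP (z \in D i).
    suff -> : S :\: D i = S :\ z :\: D i by lra.
    apply/setP=> y; rewrite !inE; case: eqP => [->|//].
    by rewrite zD.
  have := f_sub (S :\ z) (S :\: D i).
  have -> : (S :\ z) :|: (S :\: D i) = S.
    apply/setP=> y; rewrite !inE; case: eqP => [->|_]; first by rewrite zD.
    by case: (y \in S); rewrite ?andbF.
  have -> : (S :\ z) :&: (S :\: D i) = S :\ z :\: D i.
    by apply/setP=> y; rewrite !inE; case: (y \in S); case: (_ == _); case: (_ \in _).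
  lra.
have -> : \sum_(i in P) (if z \in D i then f S - f (S :\ z) else 0) =
    #|[set i in P | z \in D i]|%:R * (f S - f (S :\ z)).
  rewrite -big_mkcondr /= sumr_const mulr_natl; congr (_ *+ _).
  by apply: eq_card => i; rewrite !inE.
have : #|[set i in P | z \in D i]|%:R * (f S - f (S :\ z)) <=
       p%:R * (f S - f (S :\ z)).
  by apply: ler_wpM2r; [lra | rewrite ler_nat; exact: Hp].
lra.
Qed.

End Submodular.

(** * Independent events and the expected gain from a random entrant *)

Lemma bernoulli_inequality (R : realType) (x : R) n :
  0 <= x <= 1 -> 1 - n%:R * x <= (1 - x) ^+ n.
Proof.
move=> /andP[x0 x1]; elim: n => [|n IH]; first by rewrite mul0r subr0 expr0.
have h : (1 - x) * (1 - n%:R * x) <= (1 - x) * (1 - x) ^+ n.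
  by apply: ler_wpM2l => //; lra.
have h2 : 0 <= n%:R * (x * x) by rewrite mulr_ge0 // mulr_ge0.
rewrite exprS; apply: le_trans h; rewrite -natr1; nra.
Qed.

(* The left-hand side is the probability that exactly one of independent events
   with probabilities [u x] occurs. *)
Lemma exactly_one_le1 (R : realType) (N : finType) (u : N -> R) :
  (forall x, 0 <= u x <= 1) ->
  \sum_o (u o * \prod_(x | x != o) (1 - u x)) <= 1.
Proof.
move=> u01.
have u0 x : 0 <= u x by have /andP[] := u01 x.
have v0 x : 0 <= 1 - u x by have /andP[] := u01 x; rewrite subr_ge0.
(* Expanded over the set [J] of events that occur, this product contains the left-hand side as its
   singleton terms. *)
have E1 : \prod_x (u x + (1 - u x)) = 1 by rewrite big1 // => x _; ring.
rewrite -[leRHS]E1 bigA_distr.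
pose F (J : {set N}) := \prod_i (if i \in J then u i else 1 - u i).
have F0 J : 0 <= F J by apply: prodr_ge0 => i _; case: ifP.
rewrite (eq_bigr (fun o => F [set o])); last first.
  move=> o _; rewrite /F [RHS](bigD1 o) //= set11; congr (_ * _).
  by apply: eq_bigr => x xo; rewrite inE (negPf xo).
rewrite (eq_bigl [in [set: N]]) => [|x]; last by rewrite inE.
rewrite -(big_imset F (h := set1) (A := setT)) /=; last first.
  by move=> x y _ _; exact: set1_inj.
rewrite [leRHS](bigID [in set1 @: [set: N]]) /= lerDl.
by apply: sumr_ge0 => J _; exact: F0.
Qed.

Section IndependentMax.
Variables (R : realType) (N L : finType) (A B : N -> {set L}) (m : nat).
Hypotheses (sBA : forall x, B x \subset A x) (m_gt0 : (0 < m)%N)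
  (cBA : forall x, (#|A x| <= m * #|B x|)%N).

Lemma sum_family_prod (F : N -> L -> R) :
  \sum_(w in family (fun x => mem (A x))) \prod_x F x (w x) =
  \prod_x \sum_(l in A x) F x l.
Proof. by rewrite (bigA_distr_big_dep (fun x => mem (A x))). Qed.

(** Here [A x] holds the equally likely labels of [x] and [B x] those with which it enters. After
    thinning to probability exactly [1 / m], the events that a given [o] is the only entrant from
    [O] are disjoint and have probability [1 / m * (1 - 1 / m) ^ (#|O| - 1)], which Bernoulli's
    inequality bounds below. *)
Lemma independent_max_ge (O : {set N}) (g : N -> R) (G : {ffun N -> L} -> R) :
  (forall o, 0 <= g o) ->
  (forall w, w \in family (fun x => mem (A x)) -> 0 <= G w) ->
  (forall w o, w \in family (fun x => mem (A x)) -> o \in O -> w o \in B o ->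
     g o <= G w) ->
  #|family (fun x => mem (A x))|%:R *
    ((1 - #|O|%:R / m%:R) / m%:R * \sum_(o in O) g o) <=
  \sum_(w in family (fun x => mem (A x))) G w.
Proof.
move=> g0 G0 gG; set P := family _.
have [x0 /eqP A0|Apos] := pickP (fun x => #|A x| == 0%N).
  have P0 w : w \in P = false.
    by apply/negP => /familyP/(_ x0); rewrite /= (cards0_eq A0) inE.
  by rewrite (eq_card0 P0) mul0r big1 // => w; rewrite P0.
have mR : (0 : R) < m%:R by rewrite ltr0n.
have aR x : (0 : R) < #|A x|%:R by rewrite ltr0n lt0n Apos.
have bR x : (0 : R) < #|B x|%:R.
  by rewrite ltr0n lt0n; apply: contraFneq (Apos x) => B0; have := cBA x;
    rewrite B0 muln0 leqn0.
(* A random thinning of [B x] that has probability exactly [1 / m]. *)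
pose u x (l : L) : R :=
  if (x \in O) && (l \in B x) then #|A x|%:R / (m%:R * #|B x|%:R) else 0.
have u01 x l : 0 <= u x l <= 1.
  rewrite /u; case: ifP => _; last by rewrite lexx ler01.
  have mb : (0 : R) < m%:R * #|B x|%:R by rewrite mulr_gt0.
  rewrite divr_ge0 ?(ltW mb) ?ler0n //= ler_pdivrMr // mul1r -natrM ler_nat.
  exact: cBA.
have u0 x l : 0 <= u x l by have /andP[] := u01 x l.
have v0 x l : 0 <= 1 - u x l by have /andP[] := u01 x l; rewrite subr_ge0.
have uE x : x \in O -> \sum_(l in A x) u x l = #|A x|%:R / m%:R.
  move=> xO; rewrite /u xO /= -big_mkcondr /=.
  rewrite (eq_bigl [in B x]); last first.
    by move=> l /=; rewrite andbC; case: (boolP (l \in B x)) => // /(subsetP (sBA x)).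
  rewrite sumr_const -mulr_natl; field.
  by rewrite !lt0r_neq0.
have vE x : \sum_(l in A x) (1 - u x l) =
    #|A x|%:R * (if x \in O then 1 - m%:R^-1 else 1).
  rewrite sumrB sumr_const; case: (boolP (x \in O)) => xO.
    by rewrite uE // mulrBr mulr1.
  rewrite mulr1 big1 ?subr0 // => l _; by rewrite /u (negPf xO).
(* The probability, given the labels [w], that [o] alone survives the thinning. *)
pose W o (w : {ffun N -> L}) := u o (w o) * \prod_(x | x != o) (1 - u x (w x)).
have W0 o w : 0 <= W o w by rewrite mulr_ge0 // prodr_ge0.
have WG w : w \in P -> \sum_(o in O) W o w * g o <= G w.
  move=> wP; apply: (@le_trans _ _ ((\sum_(o in O) W o w) * G w)).
    rewrite mulr_suml; apply: ler_sum => o oO.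
    have [wB|wB] := boolP (w o \in B o); first by rewrite ler_wpM2l // gG.
    by rewrite /W /u oO (negPf wB) !mul0r.
  rewrite -[leRHS]mul1r ler_wpM2r ?G0 //.
  apply: le_trans (exactly_one_le1 (fun x => u01 x (w x))).
  by rewrite [leRHS](bigID [in O]) /= lerDl sumr_ge0 // => o _; exact: W0.
have cP : #|P|%:R = \prod_x #|A x|%:R :> R.
  transitivity (\sum_(w in P) \prod_(x : N) (1 : R)).
    by rewrite big1_eq sumr_const.
  rewrite (sum_family_prod (fun _ _ => 1)); apply: eq_bigr => x _.
  by rewrite sumr_const.
have EW o : o \in O ->
    \sum_(w in P) W o w = #|P|%:R * (m%:R^-1 * (1 - m%:R^-1) ^+ #|O|.-1).
  move=> oO; pose F x l := if x == o then u x l else 1 - u x l.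
  rewrite (eq_bigr (fun w : {ffun N -> L} => \prod_x F x (w x))); last first.
    move=> w _; rewrite [RHS](bigD1 o) //= /F eqxx; congr (_ * _).
    by apply: eq_bigr => x /negPf ->.
  rewrite sum_family_prod cP [LHS](bigD1 o) //= [X in _ = X * _](bigD1 o) //=.
  rewrite (eq_bigr (u o)) => [|l _]; last by rewrite /F eqxx.
  rewrite uE // (eq_bigr (fun x => #|A x|%:R * (if x \in O then 1 - m%:R^-1 else 1))).
    rewrite big_split /= -!mulrA; congr (_ * _).
    rewrite mulrCA; congr (_ * (_ * _)).
    rewrite -big_mkcondr /= (eq_bigl [in O :\ o]) => [|x]; last by rewrite !inE.
    by rewrite prodr_const (cardsD1 o O) oO.
  by move=> x /negPf xo; rewrite -vE; apply: eq_bigr => l _; rewrite /F xo.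
apply: (@le_trans _ _ (\sum_(w in P) \sum_(o in O) W o w * g o)); last first.
  by apply: ler_sum => w wP; exact: WG.
rewrite exchange_big /= !mulr_sumr; apply: ler_sum => o oO.
rewrite -mulr_suml EW // -!mulrA ler_wpM2l // !mulrA ler_wpM2r //.
rewrite mulrC ler_wpM2l ?invr_ge0 ?ler0n //.
have i01 : 0 <= (m%:R^-1 : R) <= 1.
  by rewrite invr_ge0 ler0n invf_le1 // ler1n.
apply: le_trans (bernoulli_inequality #|O|.-1 i01).
rewrite lerD2l lerN2 ler_wpM2r ?invr_ge0 ?ler0n // ler_nat leq_pred //.
Qed.

End IndependentMax.

(** * Swaps of a new element into a feasible set *)

Definition oracle (N : finType) (q : nat) (M : 'I_q -> matroid N) (l : 'I_q)
  (A : {set N}) : bool := A :&: ground (M l) \in indep (M l).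

Section Swaps.
Variables (N : finType) (q : nat) (ind : 'I_q -> {set N} -> bool).
Variables (S : {set N}) (y : N).

(* What matroid [l] may evict from [S] to make room for [y]: nothing if it
   accepts [y |: S], and otherwise one element. *)
Definition evictable (l : 'I_q) : pred (option N) := fun o =>
  if o is Some z then [&& ~~ ind l (y |: S), z \in S & ind l (y |: S :\ z)]
  else ind l (y |: S).

Definition evicted (phi : {ffun 'I_q -> option N}) : {set N} :=
  [set z | [exists l, phi l == Some z]].

Definition swaps : seq {set N} :=
  [seq y |: (S :\: evicted phi) | phi <- enum (family evictable)].

Lemma swaps_sub A : A \in swaps -> A \subset y |: S.
Proof.
by case/mapP => phi _ ->; rewrite setUS // subsetDl.
Qed.

Lemma size_swaps : size swaps = (\prod_l #|evictable l|)%N.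
Proof.
by rewrite size_map -cardE card_family foldrE big_map big_enum.
Qed.

End Swaps.

(** The algorithm queries the matroids only on subsets of [y |: S]; this identifies its swaps with
    those of the true oracle. *)
Lemma eq_swaps (N : finType) q (ind ind' : 'I_q -> {set N} -> bool)
    (S : {set N}) (y : N) :
  (forall l (A : {set N}), A \subset y |: S -> ind l A = ind' l A) ->
  swaps ind S y = swaps ind' S y.
Proof.
move=> E; congr map; apply: eq_enum => phi.
apply: eq_forallb => l; rewrite !unfold_in /evictable /= E //.
by case: (phi l) => // z; rewrite E // setUS // subsetDl.
Qed.

Section MatchoidSwaps.
Variables (N : finType) (q p : nat) (M : 'I_q -> matroid N).
Hypothesis matchoidM : is_matchoid p M.
Local Notation ind := (oracle M).

Lemma feasibleP S : reflect (forall l, ind l S) (S \in feasible M).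
Proof. by rewrite inE; apply: forallP. Qed.

Lemma set0_feasible : set0 \in feasible M.
Proof. by apply/feasibleP => l; rewrite /oracle set0I indep0. Qed.

Lemma violated_ground S y l :
  S \in feasible M -> ~~ ind l (y |: S) -> y \in ground (M l).
Proof.
move=> /feasibleP/(_ l); rewrite /oracle => iS; apply: contraR => yl.
rewrite setIUl (_ : [set y] :&: _ = set0) ?set0U //.
by apply/setP=> z; rewrite !inE; case: eqP => // ->; rewrite (negPf yl).
Qed.

Lemma swaps_feasible S y A :
  S \in feasible M -> A \in swaps ind S y -> A \in feasible M.
Proof.
move=> fS /mapP[phi]; rewrite mem_enum => /familyP phiP ->.
apply/feasibleP => l; have := phiP l; rewrite unfold_in.
case E: (phi l) => [z|] /=.
  case/and3P=> _ _; rewrite /oracle; apply: indep_sub.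
  rewrite setSI // setUS // setDS // sub1set inE; apply/existsP; exists l.
  by rewrite E.
by rewrite /oracle; apply: indep_sub; rewrite setSI // setUS // subsetDl.
Qed.

(** Only the at most [p] matroids containing [y] can reject [y |: S]. Each of them then offers at
    most its rank many evictions, since evicting an element outside its ground set would not help.
    The other matroids leave a single choice. *)
Lemma size_swaps_le S y : S \in feasible M -> (0 < max_rk M)%N ->
  (size (swaps ind S y) <= max_rk M ^ p)%N.
Proof.
move=> fS k0; rewrite size_swaps.
apply: (@leq_trans (\prod_(l | ~~ ind l (y |: S)) max_rk M)%N).
  rewrite [leqRHS]big_mkcond /=; apply: leq_prod => l _; case: ifPn => [nI|/negPn I].
    apply: (@leq_trans #|S :&: ground (M l)|).
      have injS : injective (@Some N) by move=> ? ? [].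
      rewrite -(card_imset _ injS).
      apply: subset_leq_card; apply/subsetP => -[z|]; rewrite unfold_in /=; last first.
        by rewrite (negPf nI).
      case/and3P=> _ zS iz; apply: imset_f; rewrite inE zS /=.
      apply: contraR nI => zl; move: iz; rewrite /oracle.
      suff -> : (y |: S :\ z) :&: ground (M l) = (y |: S) :&: ground (M l) by [].
      apply/setP=> x; rewrite !inE.
      by have [->|//] := eqVneq x z; rewrite (negPf zl) !andbF.
    apply: leq_trans (leq_bigmax (F := fun l => rk (M l)) l).
    exact: (leq_bigmax_cond (P := [in indep (M l)]) (F := fun A : {set N} => #|A|) _ (feasibleP _ fS l)).
  rewrite -(card1 (None : option N)); apply: subset_leq_card.
  by apply/subsetP => -[z|//]; rewrite unfold_in /= I.
rewrite prod_nat_const leq_pexp2l //.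
apply: leq_trans (matchoidM.2 y); apply: subset_leq_card; apply/subsetP=> l.
by rewrite !inE; apply: violated_ground.
Qed.

Lemma max_rk_gt0 : (0 < max_feasible_size M)%N -> (0 < max_rk M)%N.
Proof.
rewrite !lt0n; apply: contraNneq => r0; rewrite -leqn0.
apply/bigmax_leqP => S /feasibleP fS; rewrite leqn0 cards_eq0.
apply/eqP/setP => y; rewrite inE; apply/negP => yS.
have : y \in \bigcup_l ground (M l) by rewrite matchoidM.1 inE.
case/bigcupP=> l _ yl.
have : (#|S :&: ground (M l)| <= max_rk M)%N.
  apply: leq_trans (leq_bigmax (F := fun l => rk (M l)) l).
  exact: (leq_bigmax_cond (P := [in indep (M l)]) (F := fun A : {set N} => #|A|) _ (fS l)).
rewrite r0 leqn0 cards_eq0 => /eqP/setP/(_ y).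
by rewrite !inE yS yl.
Qed.

Variables (R : realType) (v : {set N} -> R).
Hypotheses (v_ge0 : nonnegative v) (v_mono : monotone v) (v_sub : submodular v).

(* Pairing [O] with [S] by exchange in every matroid, each element of [S] is
   evicted at most [p] times in total. *)
Lemma swap_gain_sum (S O : {set N}) (g : N -> R) :
  S \in feasible M -> O \in feasible M -> (forall o, 0 <= g o) ->
  (forall o A, A \in swaps ind S o -> v A - v S <= g o) ->
  v O - p.+1%:R * v S <= \sum_(o in O) g o.
Proof.
move=> fS fO g0 gA.
have /fin_all_exists[phi phiP] (l : 'I_q) :=
  exchange_injection (feasibleP _ fS l) (feasibleP _ fO l).
have indU l o A : o \in ground (M l) ->
    ind l (o |: A) = (o |: (A :&: ground (M l)) \in indep (M l)).
  move=> ol; rewrite /oracle.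
  suff -> : (o |: A) :&: ground (M l) = o |: (A :&: ground (M l)) by [].
  by apply/setP=> z; rewrite !inE; case: eqP => // ->.
have phiV l o : o \in O -> ~~ ind l (o |: S) ->
    [/\ phi l o \in S, phi l o \in ground (M l), ind l (o |: S :\ phi l o)
      & forall c, c \in O -> ~~ ind l (c |: S) -> phi l c = phi l o -> c = o].
  move=> oO nI; have ol := violated_ground fS nI.
  have [||] := phiP l o; first by rewrite inE oO.
    by rewrite -indU.
  move=> /setIP[pS pl] i inj; split=> //.
    rewrite indU //; suff -> : (S :\ phi l o) :&: ground (M l) =
      S :&: ground (M l) :\ phi l o by [].
    by apply/setP=> z; rewrite !inE andbA.
  move=> c cO cI; have cl := violated_ground fS cI.
  by apply: inj; rewrite ?inE ?cO // -indU.
pose psi o : {ffun 'I_q -> option N} :=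
  [ffun l => if ind l (o |: S) then None else Some (phi l o)].
pose D o := evicted (psi o).
have sw o : o \in O -> o |: (S :\: D o) \in swaps ind S o.
  move=> oO; apply: map_f; rewrite mem_enum; apply/familyP => l.
  rewrite ffunE unfold_in; case: ifPn => //= nI.
  by have [-> _ ->] := phiV _ _ oO nI.
have cnt z : z \in S -> (#|[set o in O :\: S | z \in D o]| <= p)%N.
  move=> zS; apply: leq_trans (matchoidM.2 z).
  (* A matroid in which the swap of [o] evicts [z]. It contains [z], and by injectivity of the
     exchange there it determines [o]; so at most [p] swaps evict [z]. *)
  pose F o := [pick l | psi o l == Some z].
  have FP o : z \in D o -> exists2 l, F o = Some l & psi o l = Some z.
    rewrite inE => /existsP[l0 zl0]; rewrite /F; case: pickP => [l /eqP|/(_ l0)].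
      by exists l.
    by rewrite zl0.
  have psiE o l : psi o l = Some z -> ~~ ind l (o |: S) /\ phi l o = z.
    by rewrite ffunE; case: ifP => // _ [].
  rewrite -(card_in_imset (f := F)); last first.
    move=> o c /setIdP[/setDP[oO _] zo] /setIdP[/setDP[cO _] zc].
    have [l -> /psiE[io po]] := FP o zo.
    have [k -> /psiE[ic pc]] := FP c zc.
    case=> kl; subst k; have [_ _ _ inj] := phiV _ _ cO ic.
    by apply: inj; rewrite ?po.
  have injS : injective (@Some 'I_q) by move=> ? ? [].
  rewrite -[leqRHS](card_imset _ injS).
  apply: subset_leq_card; apply/subsetP => _ /imsetP[o + ->].
  case/setIdP=> /setDP[oO _] zo.
  have [l -> /psiE[io po]] := FP o zo.
  apply: imset_f; rewrite inE -po.
  by have [] := phiV _ _ oO io.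
have := removal_sum_le v_mono v_sub cnt.
have := marginal_sum_ge v_mono v_sub S (enum (O :\: S)).
rewrite big_enum /=.
have -> : [set x in enum (O :\: S)] = O :\: S by apply/setP=> z; rewrite !inE mem_enum inE.
have : v O <= v (S :|: O :\: S).
  by apply: v_mono; apply/subsetP=> z zO; rewrite !inE zO andbT orbN.
(* By submodularity [o] adds no more to [S] than to [S :\: D o]; its marginal value is thus at most
   the gain of the swap plus the loss due to the evictions. *)
have : \sum_(o in O :\: S) (v (o |: S) - v S) <=
    \sum_(o in O :\: S) g o + \sum_(o in O :\: S) (v S - v (S :\: D o)).
  rewrite -big_split /=; apply: ler_sum => o /setDP[oO oS].
  have := gA _ _ (sw _ oO); have := v_sub (o |: (S :\: D o)) S.
  have -> : o |: (S :\: D o) :|: S = o |: S.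
    by apply/setP=> z; rewrite !inE; case: (z \in S); rewrite ?orbT // andbF !orbF.
  have -> : (o |: (S :\: D o)) :&: S = S :\: D o.
    apply/setP=> z; rewrite !inE; case: eqP => [->|_] /=.
      by rewrite (negPf oS) andbF.
    by rewrite -andbA andbb.
  lra.
have : \sum_(o in O :\: S) g o <= \sum_(o in O) g o.
  rewrite [leRHS](big_setID S) /= lerDr; apply: sumr_ge0 => o _; exact: g0.
have : p%:R * (v S - v set0) <= p%:R * v S.
  by rewrite ler_wpM2l // gerBl.
rewrite -natr1; lra.
Qed.

End MatchoidSwaps.

(* The window in which an element arrives, and one coin per window, which comes up
   if it is [0]. *)
Definition label (m' : nat) : finType :=
  ('I_m'.+1 * {ffun 'I_m'.+1 -> 'I_m'.+1})%type.

Definition update_best (R : realType) (N : finType) (b : R * {set N}) (r : R)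
  (A : {set N}) : R * {set N} := if b.1 < r then (r, A) else b.

(* Ties are broken on the index, so that whether an element wins a window does
   not depend on the order in which the candidates are examined. *)
Definition beats (R : realType) (n : nat) (x : R) (y : 'I_n) (x' : R) (z : 'I_n) :=
  (x' < x) || (x == x') && (y < z)%N.

(** * The idealised process on labelled elements *)

Section Process.
Variables (R : realType) (n q m' : nat).
Variables (v : {set 'I_n} -> R) (ind : 'I_q -> {set 'I_n} -> bool).

(** The fold starts from [S] itself: only a strict improvement replaces it. *)
Definition best_swap (S : {set 'I_n}) (y : 'I_n) : R * {set 'I_n} :=
  foldl (fun b A => update_best b (v A) A) (v S, S) (swaps ind S y).

Lemma best_swapP S y :
  [/\ (best_swap S y).1 = v (best_swap S y).2, v S <= (best_swap S y).1,
      forall A, A \in swaps ind S y -> v A <= (best_swap S y).1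
    & (best_swap S y).2 = S \/ (best_swap S y).2 \in swaps ind S y].
Proof.
rewrite /best_swap; elim/last_ind: (swaps ind S y) => [|L A [h1 h2 h3 h4]].
  by split=> //; left.
rewrite foldl_rcons; set b := foldl _ _ L in h1 h2 h3 h4 *.
rewrite /update_best; case: ltP => [lt|le] /=.
  split=> //; first exact: le_trans h2 (ltW lt).
    move=> B; rewrite mem_rcons inE => /predU1P[->//|/h3 h].
    exact: le_trans h (ltW lt).
  by right; rewrite mem_rcons mem_head.
split=> //.
  by move=> B; rewrite mem_rcons inE => /predU1P[->//|/h3].
by case: h4; [left | right; rewrite mem_rcons inE b0 orbT].
Qed.

Local Notation val S y := (best_swap S y).1.

Definition contend (S : {set 'I_n}) (o : option 'I_n) (y : 'I_n) :=
  if o is Some z then if beats (val S y) y (val S z) z then Some y else o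
  else if v S < val S y then Some y else None.

(* [wins S o x b]: the presence ([b = true]) or absence of [x] among the
   candidates is compatible with the outcome [o] of a window. *)
Definition wins (S : {set 'I_n}) (o : option 'I_n) (x : 'I_n) (b : bool) :=
  if o is Some z then
    if x == z then b && (v S < val S z)
    else b ==> ~~ beats (val S x) x (val S z) z
  else b ==> ~~ (v S < val S x).

Lemma beats_anti S x y : beats (val S x) x (val S y) y ->
  beats (val S y) y (val S x) x = false.
Proof.
rewrite /beats; case: (ltgtP (val S x) (val S y)) => //= _ xy.
by rewrite ltnNge ltnW.
Qed.

Lemma beats_trans S x y z : beats (val S x) x (val S y) y ->
  beats (val S y) y (val S z) z -> beats (val S x) x (val S z) z.
Proof.
rewrite /beats => /orP[a|/andP[/eqP-> a]] /orP[b|/andP[/eqP<- b]].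
- by rewrite (lt_trans b a).
- by rewrite a.
- by rewrite b.
- by rewrite eqxx (ltn_trans a b) orbT.
Qed.

Lemma beats_total S x y : x != y ->
  ~~ beats (val S x) x (val S y) y -> beats (val S y) y (val S x) x.
Proof.
rewrite /beats; case: (ltgtP (val S x) (val S y)) => //= _.
by rewrite -leqNgt leq_eqVlt eq_sym => /negPf; rewrite -val_eqE /= => ->.
Qed.

(** Turns the outcome of a window into a conjunction of conditions, one for each element, which
    involve only the presence of that element. With [wins_inj] these conditions characterise the
    outcome, which is the source of independence given the history. *)
Lemma contend_wins S l x : wins S (foldl (contend S) None l) x (x \in l).
Proof.
elim/last_ind: l x => [|l y IH] x; first by [].
rewrite foldl_rcons mem_rcons inE.
case: (foldl (contend S) None l) IH => [z|] IH /=.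
  have /andP[zl gz] : (z \in l) && (v S < val S z) by have := IH z; rewrite /= eqxx.
  case: ifPn => [byz|nbyz] /=.
    have [->/=|xy /=] := eqVneq x y.
      apply: lt_le_trans gz _; case/orP: byz => [/ltW//|/andP[/eqP-> _]//].
    apply/implyP => xl; apply/negP => bxy.
    have bxz := beats_trans bxy byz.
    have := IH x; rewrite /= xl bxz /=; case: eqP => // xz.
    by rewrite xz (beats_anti byz) in bxy.
  have [->|xz] := eqVneq x z; first by rewrite zl orbT gz.
  have := IH x; rewrite /= (negPf xz).
  by have [->|//] := eqVneq x y; rewrite nbyz.
case: ifPn => [gy|ngy] /=.
  have [->//|xy /=] := eqVneq x y.
  apply/implyP => xl; have := IH x; rewrite /= xl -leNgt /= => le.
  rewrite /beats negb_or -leNgt (le_trans le (ltW gy)) /=.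
  by rewrite (lt_eqF (le_lt_trans le gy)).
by have := IH x; have [->|//] := eqVneq x y; rewrite ngy.
Qed.

(** Two different winners would both be present, and by totality of [beats] one of them would be
    beaten by the other. *)
Lemma wins_inj S (b : 'I_n -> bool) o o' :
  (forall x, wins S o x (b x)) -> (forall x, wins S o' x (b x)) -> o = o'.
Proof.
have aux z : (forall x, wins S None x (b x)) -> ~ (forall x, wins S (Some z) x (b x)).
  move=> /(_ z) + /(_ z); rewrite /= eqxx => /implyP h /andP[/h].
  by move/negPf=> ->.
case: o o' => [z|] [z'|] // h h'; [|by case: (aux z)|by case: (aux z')].
congr Some; apply/eqP/negPn/negP => zz'.
have := h z; have := h z'; have := h' z; have := h' z'; rewrite /= !eqxx.
rewrite (negPf zz') eq_sym (negPf zz') => /andP[-> _] /= n1 n2 /andP[bz _].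
by rewrite bz /= in n1; rewrite (beats_total zz' n1) in n2.
Qed.

(* The current solution, and all the elements picked so far. *)
Definition state : Type := ({set 'I_n} * {set 'I_n})%type.

Definition advance (o : option 'I_n) (st : state) : state :=
  if o is Some y then ((best_swap st.1 y).2, y |: st.2) else st.

Definition state_of (h : seq (option 'I_n)) : state := foldr advance (set0, set0) h.

Definition entrant (i : nat) (st : state) (y : 'I_n) (l : label m') : bool :=
  (l.1 == i :> nat) || (y \in st.2) && (l.2 (inord i) == ord0).

Definition winner (i : nat) (st : state) (w : {ffun 'I_n -> label m'}) :=
  foldl (contend st.1) None [seq y <- enum 'I_n | entrant i st y (w y)].

(* The outcomes of the first [i] windows, the last one first. *)
Fixpoint history (w : {ffun 'I_n -> label m'}) (i : nat) : seq (option 'I_n) :=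
  if i is i'.+1 then
    winner i' (state_of (history w i')) w :: history w i'
  else [::].

Lemma size_history w i : size (history w i) = i.
Proof. by elim: i => //= i ->. Qed.

Fixpoint compatible (x : 'I_n) (h : seq (option 'I_n)) (l : label m') : bool :=
  if h is o :: h' then
    compatible x h' l &&
    wins (state_of h').1 o x (entrant (size h') (state_of h') x l)
  else true.

(* The labels of different elements constrain a history independently. *)
Lemma history_compatible w h :
  (history w (size h) == h) = [forall x, compatible x h (w x)].
Proof.
elim: h => [|o h IH] /=; first by rewrite eqxx; apply/esym/forallP.
rewrite eqseq_cons; apply/andP/forallP => [[/eqP E /eqP Eh] x|H].
  rewrite Eh in E; move/eqP: Eh; rewrite IH => /forallP -> /=.
  rewrite -E; have := contend_wins (state_of h).1
    [seq y <- enum 'I_n | entrant (size h) (state_of h) y (w y)] x.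
  by rewrite mem_filter mem_enum andbT.
have Eh : history w (size h) == h.
  by rewrite IH; apply/forallP => x; have /andP[] := H x.
split=> //; rewrite (eqP Eh); apply/eqP.
apply: (wins_inj (S := (state_of h).1)
   (b := fun x => entrant (size h) (state_of h) x (w x))) => x.
  have := contend_wins (state_of h).1
    [seq y <- enum 'I_n | entrant (size h) (state_of h) y (w y)] x.
  by rewrite mem_filter mem_enum andbT.
by have /andP[] := H x.
Qed.

Lemma compatible_eq x h (l l' : label m') : l.1 = l'.1 ->
  (forall j, (j < size h)%N -> l.2 (inord j) = l'.2 (inord j)) ->
  compatible x h l = compatible x h l'.
Proof.
move=> E1; elim: h => //= o h IH E2.
rewrite IH => [|j jh]; last by apply: E2; exact: ltnW.
by rewrite /entrant E1 E2.
Qed.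

(** Such an element enters none of the windows of [h], and absence is compatible with every outcome
    other than its own victory. *)
Lemma compatible_fresh x h (l : label m') : x \notin (state_of h).2 ->
  (size h <= l.1)%N -> compatible x h l.
Proof.
elim: h => //= o h IH xH sh.
have xH' : x \notin (state_of h).2.
  by apply: contra xH; case: o => [y|] //= xh; rewrite inE xh orbT.
rewrite IH ?(ltnW sh) //= /entrant (gtn_eqF sh) (negPf xH') /=.
case: o xH => [z|] //=; rewrite !inE negb_or => /andP[/negPf-> _].
by [].
Qed.

Definition labels x h : {set label m'} := [set l | compatible x h l].
Definition entering x h : {set label m'} :=
  [set l in labels x h | entrant (size h) (state_of h) x l].

(* Relabelling [x] to enter window [i] (by its arrival if it has not been picked
   yet, by its coin otherwise) does not affect the previous windows. *)
Lemma card_labels x h : (size h < m'.+1)%N ->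
  (#|labels x h| <= m'.+1 * #|entering x h|)%N.
Proof.
move=> hm; set i := size h.
(* The overwritten value is kept as second component, which makes [relabel] injective. *)
pose relabel (l : label m') : label m' * 'I_m'.+1 :=
  if x \in (state_of h).2 then
    ((l.1, [ffun j => if j == inord i then ord0 else l.2 j]), l.2 (inord i))
  else ((inord i, l.2), l.1).
have inj : injective relabel.
  move=> [a c] [a' c']; rewrite /relabel; case: ifP => _ /= [].
    move=> -> E1 E2; congr (_, _); apply/ffunP => j.
    move/ffunP/(_ j): E1; rewrite !ffunE; case: eqP => // ->.
    by move=> _; apply: val_inj; rewrite /= E2.
  by move=> -> ->.
rewrite -(card_imset _ inj) -[X in (_ <= X * _)%N]card_ord mulnC -[#|'I__|]cardsT -cardsX.
apply: subset_leq_card; apply/subsetP => _ /imsetP[l + ->].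
rewrite !inE => lc; rewrite /relabel andbT.
case: ifPn => [xH|xH] /=.
  rewrite /entrant /= xH ffunE eqxx eqxx orbT andbT.
  rewrite -(@compatible_eq x h l) //= => j jh; rewrite ffunE.
  case: eqP => // /(congr1 (fun k : 'I__ => k : nat)).
  by rewrite !inordK ?(ltn_trans jh hm) // => E; rewrite E ltnn in jh.
rewrite /entrant /= inordK // eqxx /= andbT.
by apply: compatible_fresh => //=; rewrite inordK.
Qed.

End Process.

(** * Expected gain of one window *)

Section ProcessGain.
Variables (R : realType) (n q m' p : nat) (M : 'I_q -> matroid 'I_n).
Variable (v : {set 'I_n} -> R).
Hypotheses (matchoidM : is_matchoid p M)
  (v_ge0 : nonnegative v) (v_mono : monotone v) (v_sub : submodular v).
Local Notation ind := (oracle M).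
Local Notation state_of := (state_of v ind).
Local Notation history := (history v ind).

Lemma best_swap_feasible S y :
  S \in feasible M -> (best_swap v ind S y).2 \in feasible M.
Proof.
move=> fS; have [_ _ _ [->//|]] := best_swapP v ind S y.
exact: swaps_feasible.
Qed.

Lemma state_of_feasible h : (state_of h).1 \in feasible M.
Proof.
elim: h => [|[y|] h IH] //=; first exact: set0_feasible.
exact: best_swap_feasible.
Qed.

(** Given the history [h], the labels are independent and uniform on the sets [labels], so
    [independent_max_ge] applies to the gains [g] of the best swaps, whose sum over [O] is bounded
    below by [swap_gain_sum]. *)
Lemma history_gain (O : {set 'I_n}) h : O \in feasible M ->
  (size h < m'.+1)%N -> (#|O| <= m'.+1)%N ->
  \sum_(w : {ffun 'I_n -> label m'} | history w (size h) == h)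
     ((1 - #|O|%:R / m'.+1%:R) / m'.+1%:R * (v O - p.+1%:R * v (state_of h).1)) <=
  \sum_(w : {ffun 'I_n -> label m'} | history w (size h) == h)
     (v (state_of (history w (size h).+1)).1 - v (state_of h).1).
Proof.
move=> fO hm Om; set S := (state_of h).1.
have fS : S \in feasible M by exact: state_of_feasible.
pose g y := (best_swap v ind S y).1 - v S.
pose G (w : {ffun 'I_n -> label m'}) := v (advance v ind (winner v ind (size h) (state_of h) w) (state_of h)).1 - v S.
have g0 y : 0 <= g y by rewrite subr_ge0; have [] := best_swapP v ind S y.
have G0 w : 0 <= G w.
  rewrite /G; case: winner => [y|] /=; last by rewrite subrr.
  by rewrite -/S; have [<- + _ _] := best_swapP v ind S y; rewrite subr_ge0.
have gG (w : {ffun 'I_n -> label m'}) o : w o \in entering m' v ind o h -> g o <= G w.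
  rewrite !inE => /andP[_ eo].
  have := contend_wins v ind S
    [seq y <- enum 'I_n | entrant (size h) (state_of h) y (w y)] o.
  rewrite mem_filter mem_enum eo /G /winner -/S; case: foldl => [z|] /=; rewrite -/S.
    have [<- _ _ _] := best_swapP v ind S z.
    case: eqP => [->//|_]; rewrite /g lerD2r.
    by rewrite /beats negb_or -leNgt => /andP[].
  by rewrite -leNgt subrr subr_le0.
have gain : v O - p.+1%:R * v S <= \sum_(o in O) g o.
  apply: (swap_gain_sum matchoidM) => // o A As; rewrite lerD2r.
  by have [_ _ h3 _] := best_swapP v ind S o; exact: h3.
have sub x : entering m' v ind x h \subset labels m' v ind x h.
  by apply/subsetP => l /setIdP[].
have famE (w : {ffun 'I_n -> label m'}) : (history w (size h) == h) =
    (w \in family (fun x => mem (labels m' v ind x h))).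
  rewrite history_compatible; apply/forallP/familyP => H x; have := H x.
    by rewrite /= inE.
  by rewrite /= inE.
rewrite (eq_bigl _ _ famE) [leRHS](eq_bigr G); last first.
  by move=> w /eqP E /=; rewrite E.
rewrite [leRHS](eq_bigl _ _ famE) sumr_const -[leLHS]mulr_natl.
have cA x : (#|labels m' v ind x h| <= m'.+1 * #|entering m' v ind x h|)%N.
  exact: card_labels.
have := independent_max_ge sub (ltn0Sn m') cA g0 (fun w _ => G0 w)
  (fun w o _ (_ : o \in O) => gG w o).
apply: le_trans; rewrite ler_wpM2l // ler_wpM2l // divr_ge0 // subr_ge0.
by rewrite ler_pdivrMr ?ltr0n // mul1r ler_nat.
Qed.

Lemma window_gain (O : {set 'I_n}) i : O \in feasible M ->
  (i < m'.+1)%N -> (#|O| <= m'.+1)%N ->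
  \sum_(w : {ffun 'I_n -> label m'})
     ((1 - #|O|%:R / m'.+1%:R) / m'.+1%:R *
       (v O - p.+1%:R * v (state_of (history w i)).1)) <=
  \sum_(w : {ffun 'I_n -> label m'})
     (v (state_of (history w i.+1)).1 - v (state_of (history w i)).1).
Proof.
move=> fO im Om.
(* Tuples give the histories of length [i] a finite type, over which the labellings are
   partitioned. *)
pose H (w : {ffun 'I_n -> label m'}) : i.-tuple (option 'I_n) := tcast (size_history v ind w i) (in_tuple (history w i)).
have HE (w : {ffun 'I_n -> label m'}) : H w = history w i :> seq _ by rewrite val_tcast.
rewrite (partition_big H predT) //= [leRHS](partition_big H predT) //=.
apply: ler_sum => h _.
have HP (w : {ffun 'I_n -> label m'}) : (H w == h) = (history w (size h) == h).
  by rewrite -val_eqE /= HE size_tuple.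
have hm : (size h < m'.+1)%N by rewrite size_tuple.
rewrite (eq_bigl _ _ HP) [leRHS](eq_bigl _ _ HP).
have := history_gain fO hm Om.
have E (w : {ffun 'I_n -> label m'}) :
    history w (size h) == h -> history w i = h by rewrite -HP -HE => /eqP->.
move=> le_gain; apply: (le_trans _ (le_trans le_gain _)).
  by apply: ler_sum => w /E ->.
by apply: ler_sum => w /E Ei; rewrite size_tuple /= Ei.
Qed.

End ProcessGain.

(** From [1 + z <= expR z] the power is at most [expR (- p.+1%:R + t)] with
    [t = p.+1%:R / alpha%:R], and [expR t <= 1 + 2 * t] because [t <= 1 / 2]. The bound [p < m]
    keeps the base nonnegative. *)
Lemma contraction_pow_le (R : realType) (p m alpha : nat) (x : R) :
  (2 * p.+1 <= alpha)%N -> 0 <= x -> x <= alpha%:R^-1 -> (p < m)%N ->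
  (1 - p.+1%:R * ((1 - x) / m%:R)) ^+ m <=
  (expR 1 ^+ p.+1)^-1 + 2 * p.+1%:R / alpha%:R.
Proof.
move=> pa x0 xa pm; have P0 : (0 : R) < p.+1%:R by rewrite ltr0n.
have mR : (0 : R) < m%:R by rewrite ltr0n (leq_ltn_trans _ pm).
have aR : (0 : R) < alpha%:R by rewrite ltr0n (leq_trans _ pa).
have x1 : x <= 1.
  apply: le_trans xa _; rewrite invf_le1 // ler1n.
  by rewrite (leq_trans _ pa) // muln_gt0.
pose y := p.+1%:R * (1 - x).
have -> : 1 - p.+1%:R * ((1 - x) / m%:R) = 1 + - (y / m%:R) by rewrite /y mulrA.
have y1 : 0 <= 1 + - (y / m%:R).
  rewrite subr_ge0 ler_pdivrMr // mul1r; apply: (@le_trans _ _ p.+1%:R).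
    by rewrite ler_piMr ?(ltW P0) //; lra.
  by rewrite ler_nat.
apply: (@le_trans _ _ (expR (- (y / m%:R)) ^+ m)).
  by rewrite lerXn2r ?nnegrE ?expR_ge0 // expR_ge1Dx.
rewrite -expRM_natl.
pose t : R := p.+1%:R / alpha%:R.
have t2 : t <= 2^-1.
  rewrite /t ler_pdivrMr // -ler_pdivrMl ?invr_gt0 // invrK.
  by rewrite -natrM ler_nat.
have t0 : 0 <= t by rewrite divr_ge0 ?ltW.
have yt : m%:R * - (y / m%:R) <= - p.+1%:R + t.
  have -> : m%:R * - (y / m%:R) = - y by field; rewrite lt0r_neq0.
  have : p.+1%:R * x <= t by rewrite /t ler_wpM2l // ltW.
  by rewrite /y; lra.
apply: (@le_trans _ _ (expR (- p.+1%:R + t))); first by rewrite ler_expR.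
set E := (_ ^+ _)^-1.
have -> : expR (- p.+1%:R + t) = E * expR t.
  by rewrite expRD expRN -[in X in (expR X)^-1](mulr1 p.+1%:R) expRM_natl.
have E01 : 0 <= E <= 1.
  rewrite /E invr_ge0 exprn_ge0 ?expR_ge0 //= invf_le1 ?exprn_gt0 ?expR_gt0 //.
  by apply: exprn_ege1; have := expR_ge1Dx (1 : R); lra.
have e1 : expR t * (1 - t) <= 1.
  have := expR_ge1Dx (- t); rewrite expRN => h.
  have : expR t * (1 - t) <= expR t * (expR t)^-1.
    by rewrite ler_wpM2l ?expR_ge0.
  by rewrite divff // lt0r_neq0 // expR_gt0.
have e2 : expR t <= 1 + 2 * t.
  have : 0 <= expR t by exact: expR_ge0.
  nra.
rewrite -mulrA -/t; have [E0 E1] := andP E01.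
have : E * expR t <= E * (1 + 2 * t) by rewrite ler_wpM2l.
have : E * t <= t by rewrite ler_piMl.
lra.
Qed.

(** * Value of the solution after all windows *)

Section ProcessValue.
Variables (R : realType) (n q m' p : nat) (M : 'I_q -> matroid 'I_n).
Variable (v : {set 'I_n} -> R).
Hypotheses (matchoidM : is_matchoid p M)
  (v_ge0 : nonnegative v) (v_mono : monotone v) (v_sub : submodular v).
Local Notation ind := (oracle M).
Local Notation state_of := (state_of v ind).
Local Notation history := (history v ind).

(** The deficit [W * v O - p.+1%:R * X i] is at most [W * v O] at the start and shrinks in each
    window by the factor [1 - p.+1%:R * c]; [contraction_pow_le] bounds the resulting power. *)
Lemma process_value (O : {set 'I_n}) k alpha : O \in feasible M ->
  (#|O| <= k)%N -> (0 < k)%N -> m'.+1 = (alpha * k)%N -> (2 * p.+1 <= alpha)%N ->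
  #|{ffun 'I_n -> label m'}|%:R *
    (p.+1%:R^-1 * (1 - (expR 1 ^+ p.+1)^-1 - 2 * p.+1%:R / alpha%:R) * v O) <=
  \sum_(w : {ffun 'I_n -> label m'}) v (state_of (history w m'.+1)).1.
Proof.
move=> fO Ok k0 mE pa.
have a0 : (0 < alpha)%N by rewrite (leq_trans _ pa).
pose x : R := #|O|%:R / m'.+1%:R.
have mR : (0 : R) < m'.+1%:R by rewrite ltr0n.
have Om : (#|O| <= m'.+1)%N by rewrite mE (leq_trans Ok) // leq_pmull.
have xa : x <= alpha%:R^-1.
  rewrite /x ler_pdivrMr // mE natrM mulrA mulVf ?mul1r ?ler_nat //.
  by rewrite pnatr_eq0 -lt0n.
have x0 : 0 <= x by rewrite divr_ge0.
have pm : (p < m'.+1)%N.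
  rewrite mE; apply: (@leq_trans alpha); last by rewrite leq_pmulr.
  by apply: leq_trans pa; rewrite leq_pmull.
pose X i := \sum_(w : {ffun 'I_n -> label m'}) v (state_of (history w i)).1.
pose W : R := #|{ffun 'I_n -> label m'}|%:R.
pose c : R := (1 - x) / m'.+1%:R.
have c0 : 0 <= 1 - p.+1%:R * c.
  rewrite /c mulrA subr_ge0 ler_pdivrMr // mul1r.
  apply: (@le_trans _ _ (p.+1%:R * 1)); last by rewrite mulr1 ler_nat.
  by rewrite ler_wpM2l //; lra.
have step i : (i < m'.+1)%N ->
    W * v O - p.+1%:R * X i.+1 <= (1 - p.+1%:R * c) * (W * v O - p.+1%:R * X i).
  move=> im; have := window_gain matchoidM v_ge0 v_mono v_sub fO im Om.
  rewrite sumrB -/(X i) -/(X i.+1) -mulr_sumr sumrB sumr_const -[X in _ * (X - _)]mulr_natl.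
  rewrite -mulr_sumr -/(X i) -/x -/c -/W.
  have P0 : (0 : R) <= p.+1%:R by [].
  move=> h; have := ler_wpM2l P0 h; lra.
have iter i : (i <= m'.+1)%N ->
    W * v O - p.+1%:R * X i <= (1 - p.+1%:R * c) ^+ i * (W * v O).
  elim: i => [_|i IH im].
    rewrite expr0 mul1r gerBl mulr_ge0 //; apply: sumr_ge0 => w _; exact: v_ge0.
  apply: le_trans (step i im) _; rewrite exprS -mulrA ler_wpM2l //.
  by apply: IH; exact: ltnW.
have := iter _ (leqnn _); have := contraction_pow_le pa x0 xa pm.
rewrite -/c; set Q := _ ^+ _; set E := _^-1 => hQ h.
have WO : 0 <= W * v O by rewrite mulr_ge0 // v_ge0.
have P0 : (0 : R) < p.+1%:R by rewrite ltr0n.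
rewrite -/(X m'.+1) -/W -[p.+1%:R^-1 * _ * _]mulrA mulrCA ler_pdivrMl //.
have := ler_wpM2r WO hQ; lra.
Qed.

End ProcessValue.

(** * Transport of an instance from items to names along a bijection *)

Section Pullback.
Variables (N T : finType) (u : N -> T) (u_bij : bijective u).

Lemma imset_preim (A : {set T}) : u @: (u @^-1: A) = A.
Proof.
have [g gK uK] := u_bij; apply/setP => x; apply/imsetP/idP.
  by case=> y; rewrite inE => + ->.
by move=> xA; exists (g x); rewrite ?inE uK.
Qed.

Lemma imset_bij : bijective (fun A : {set N} => u @: A).
Proof.
exists (fun B : {set T} => u @^-1: B) => A; last exact: imset_preim.
by apply/setP => x; rewrite inE mem_imset //; exact: bij_inj.
Qed.

Section One.
Variable M : matroid T.

Lemma pullback_ground A :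
  A \in [set A : {set N} | u @: A \in indep M] -> A \subset u @^-1: ground M.
Proof. by rewrite inE => /indep_ground; rewrite sub_imset_pre. Qed.

Lemma pullback0 : set0 \in [set A : {set N} | u @: A \in indep M].
Proof. by rewrite inE imset0 indep0. Qed.

Lemma pullback_sub (A B : {set N}) : A \subset B ->
  B \in [set A : {set N} | u @: A \in indep M] ->
  A \in [set A : {set N} | u @: A \in indep M].
Proof. by rewrite !inE => AB; apply: indep_sub; exact: imsetS. Qed.

Lemma pullback_aug (A B : {set N}) :
  A \in [set A : {set N} | u @: A \in indep M] ->
  B \in [set A : {set N} | u @: A \in indep M] -> (#|A| < #|B|)%N ->
  exists2 x, x \in B :\: A & x |: A \in [set A : {set N} | u @: A \in indep M].
Proof.
have uI := bij_inj u_bij.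
rewrite !inE => iA iB; rewrite -(card_imset _ uI) -[in X in (_ < X)%N](card_imset _ uI).
move=> /(indep_aug iA iB)[_ /setDP[/imsetP[y yB ->] nA] i].
exists y; rewrite !inE ?imsetU1 // yB andbT.
by apply: contra nA; exact: imset_f.
Qed.

Definition pullback : matroid N :=
  Matroid pullback_ground pullback0 pullback_sub pullback_aug.

Lemma rk_pullback : rk pullback = rk M.
Proof.
rewrite /rk [RHS](reindex (fun A : {set N} => u @: A)) /=; last exact: onW_bij imset_bij.
by apply: eq_big => [A|A _]; rewrite ?inE // card_imset //; exact: bij_inj.
Qed.

End One.

Variables (q : nat) (M : 'I_q -> matroid T).
Local Notation M' := (fun l => pullback (M l)).

Lemma oracle_pullback l A : oracle M' l A = (u @: A :&: ground (M l) \in indep (M l)).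
Proof.
rewrite /oracle inE /= imsetI ?imset_preim //.
by move=> x y _ _; exact: bij_inj u_bij x y.
Qed.

Lemma feasible_pullback A : (A \in feasible M') = (u @: A \in feasible M).
Proof.
by apply/feasibleP/feasibleP => H l; have := H l; rewrite oracle_pullback.
Qed.

Lemma max_feasible_size_pullback : max_feasible_size M' = max_feasible_size M.
Proof.
rewrite /max_feasible_size [RHS](reindex (fun A : {set N} => u @: A)) /=.
  apply: eq_big => [A|A _]; first exact: feasible_pullback.
  by rewrite card_imset //; exact: bij_inj.
exact: onW_bij imset_bij.
Qed.

Lemma max_rk_pullback : max_rk M' = max_rk M.
Proof. by apply: eq_bigr => l _; exact: rk_pullback. Qed.

Lemma matchoid_pullback p : is_matchoid p M -> is_matchoid p M'.
Proof.
case=> cov deg; split=> [|e].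
  apply/setP=> y; rewrite inE; have : u y \in \bigcup_l ground (M l) by rewrite cov inE.
  by case/bigcupP => l _ yl; apply/bigcupP; exists l; rewrite //= inE.
apply: leq_trans (deg (u e)); rewrite subset_leq_card //.
by apply/subsetP => l; rewrite !inE.
Qed.

Variables (R : realType) (f : {set T} -> R).

Lemma nonnegative_pullback : nonnegative f -> nonnegative (fun A => f (u @: A)).
Proof. by move=> H A. Qed.

Lemma monotone_pullback : monotone f -> monotone (fun A : {set N} => f (u @: A)).
Proof. by move=> H A B AB; apply: H; exact: imsetS. Qed.

Lemma submodular_pullback : submodular f -> submodular (fun A : {set N} => f (u @: A)).
Proof.
move=> H A B /=; rewrite imsetU imsetI; first exact: (H (u @: A) (u @: B)).
by move=> x y _ _; exact: bij_inj u_bij x y.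
Qed.

End Pullback.

(** * Building blocks of the streaming algorithm *)

Section Combinators.
Variables (R : realType) (n q : nat).
Local Notation alg := (stream_alg R n q).

(** The answers are collected in a function that is overridden at each query, so that the
    continuation can use it like an oracle. *)
Fixpoint ask_all (L : seq ('I_q * {set 'I_n})) (ans : 'I_q -> {set 'I_n} -> bool)
    (k : ('I_q -> {set 'I_n} -> bool) -> alg) : alg :=
  if L is la :: L' then
    Indep la.1 la.2 (fun b =>
      ask_all L' (fun l A => if (l, A) == la then b else ans l A) k)
  else k ans.

Fixpoint try_all (h : 'I_n -> 'I_n) (L : seq {set 'I_n}) (b : R * {set 'I_n})
    (k : R * {set 'I_n} -> alg) : alg :=
  if L is A :: L' then
    Eval (h @: A) (fun r => try_all h L' (update_best b r A) k)
  else k b.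

(** [Draw] yields ordinals only. The element [x0] is the default of [nth] and shows that [X] is
    nonempty, whence [#|X|.-1.+1 = #|X|]. *)
Definition draw (X : finType) (x0 : X) (c : X -> alg) : alg :=
  Draw #|X|.-1 (fun i => c (nth x0 (enum X) i)).

Variables (T : finType) (M : 'I_q -> matroid T) (f : {set T} -> R).
Variable s : {ffun 'I_n -> T}.

Lemma legal_draw (X : finType) (x0 : X) c cap t B :
  (forall x, legal M f s cap t B (c x)) -> legal M f s cap t B (draw x0 c).
Proof. by move=> H i; exact: H. Qed.

Lemma evals_draw (X : finType) (x0 : X) c e :
  (forall x, (evals M f s (c x) <= e)%N) -> (evals M f s (draw x0 c) <= e)%N.
Proof. by move=> H; apply/bigmax_leqP => i _. Qed.

Lemma draw_expectation_draw (X : finType) (x0 : X) c :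
  draw_expectation M f s (draw x0 c) =
  (\sum_x draw_expectation M f s (c x)) / #|X|%:R.
Proof.
have X0 : (0 < #|X|)%N by apply/card_gt0P; exists x0.
rewrite /= prednK //; congr (_ / _).
by rewrite -[RHS]big_enum (big_nth x0) big_mkord -cardE.
Qed.

Variable cap : nat.

(** The last clause asks for one output value because the runs described start after the labels are
    drawn and are deterministic. *)
Definition run_spec (t : nat) (B : {set 'I_n}) (e : nat) (X : {set 'I_n})
    (P : alg) : Prop :=
  [/\ legal M f s cap t B P, (evals M f s P <= e)%N
    & draw_expectation M f s P = f (items s X)].

Lemma run_spec_ask (L : seq ('I_q * {set 'I_n})) ans t (B : {set 'I_n}) e X k :
  (forall la, la \in L -> la.2 \subset B) ->
  (forall ans', (forall l (A : {set 'I_n}), (l, A) \in L -> ans' l A = indep_answer M s l A) ->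
     run_spec t B e X (k ans')) ->
  run_spec t B e X (ask_all L ans k).
Proof.
move=> LB H.
(* Generalised to queries that are still in the list or have already been answered correctly. *)
have {H} : forall ans', (forall l (A : {set 'I_n}),
    (l, A) \in L \/ ans l A = indep_answer M s l A ->
    ans' l A = indep_answer M s l A) -> run_spec t B e X (k ans').
  by move=> ans' H'; apply: H => l A lA; apply: H'; left.
elim: L ans LB => [|la L IH] ans LB H /=.
  by apply: H => l A [].
have [||h1 h2 h3] := IH (fun l A =>
    if (l, A) == la then indep_answer M s la.1 la.2 else ans l A).
- by move=> lb Hlb; apply: LB; rewrite inE Hlb orbT.
- move=> ans' H'; apply: H => l A; rewrite inE => -[/predU1P[E|lA]|E]; apply: H'.
  + by right; rewrite E eqxx -E.
  + by left.
  + by right; case: eqP => // <-.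
split=> //=; split=> //; apply: LB; exact: mem_head.
Qed.

Lemma run_spec_try h (L : seq {set 'I_n}) (b : R * {set 'I_n}) t (B : {set 'I_n}) e X k : (forall A, A \in L -> h @: A \subset B) ->
  run_spec t B e X
    (k (foldl (fun (b : R * {set 'I_n}) (A : {set 'I_n}) => update_best b (f (items s (h @: A))) A) b L)) ->
  run_spec t B (e + size L) X (try_all h L b k).
Proof.
elim: L b => [|A L IH] b LB H /=; first by rewrite addn0.
have [|//|h1 h2 h3] := IH (update_best b (f (items s (h @: A))) A).
  by move=> C CL; apply: LB; rewrite inE CL orbT.
split=> //=; last by rewrite addnS ltnS.
by split=> //; apply: LB; exact: mem_head.
Qed.

End Combinators.

(** * Arrival positions of the named items *)

Section Schedule.
Variables (n m' : nat).
Variable w : {ffun 'I_n -> label m'}.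

Definition arrivals (i : nat) : seq 'I_n :=
  [seq y <- enum 'I_n | (w y).1 == i :> nat].

(* The [t]-th arriving item is given the name [nth t schedule]; the names of
   the items that arrive in window [i] are those labelled [i]. *)
Definition schedule : seq 'I_n := flatten [seq arrivals i | i <- iota 0 m'.+1].

Definition handle (y : 'I_n) : 'I_n := insubd y (index y schedule).

Lemma mem_schedule y : y \in schedule.
Proof.
apply/flatten_mapP; exists ((w y).1 : nat); first by rewrite mem_iota /= add0n.
by rewrite mem_filter eqxx mem_enum.
Qed.

Lemma schedule_uniq : uniq schedule.
Proof.
rewrite /schedule; elim: m'.+1 0%N => //= c IH i.
rewrite cat_uniq filter_uniq ?enum_uniq // IH andbT /=.
apply/hasPn => y /flatten_mapP[j]; rewrite mem_iota => /andP[ij _].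
rewrite !mem_filter => /andP[/eqP-> _].
by rewrite gtn_eqF.
Qed.

Lemma size_schedule : size schedule = n.
Proof.
rewrite -[RHS](size_enum_ord n); apply: perm_size.
apply: uniq_perm; rewrite ?schedule_uniq ?enum_uniq // => y.
by rewrite mem_schedule mem_enum.
Qed.

Lemma val_handle y : val (handle y) = index y schedule.
Proof. by rewrite val_insubd -[X in (_ < X)%N]size_schedule index_mem mem_schedule. Qed.

Lemma handle_inj : injective handle.
Proof.
move=> x y /(congr1 val); rewrite !val_handle => E.
by rewrite -(nth_index x (mem_schedule x)) E nth_index // mem_schedule.
Qed.

(** Identifies what [Read] delivers at time [t]: the item of the next name in the schedule. *)
Lemma drop_schedule t y r : drop t schedule = y :: r ->
  [/\ (t < n)%N, [set i : 'I_n | val i == t] = [set handle y]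
    & drop t.+1 schedule = r].
Proof.
move=> E; have tn : (t < n)%N.
  have : ~~ (size schedule <= t)%N by apply/negP => /drop_oversize; rewrite E.
  by rewrite size_schedule -ltnNge.
have ny : nth y schedule t = y by rewrite -[t]addn0 -nth_drop E.
have iy : index y schedule = t.
  by rewrite -{1}ny index_uniq ?schedule_uniq // size_schedule.
split=> //; last by rewrite -add1n -drop_drop E /= drop0.
by apply/setP=> i; rewrite !inE -val_eqE /= val_handle iy.
Qed.

End Schedule.

(** * The streaming implementation and its agreement with the process *)

Section Algorithm.
Variables (R : realType) (n q m' : nat).
Variable w : {ffun 'I_n -> label m'}.
Local Notation alg := (stream_alg R n q).
Local Notation h := (handle w).
Local Notation leader := (option ('I_n * (R * {set 'I_n}))).

(** [contend], with the leader's best swap and its value carried along, which saves evaluating it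
    again. *)
Definition challenge (vS : R) (cur : leader) (y : 'I_n) (b : R * {set 'I_n}) : leader :=
  if cur is Some (z, c) then if beats b.1 y c.1 z then Some (y, b) else cur
  else if vS < b.1 then Some (y, b) else None.

Definition pickset (o : option 'I_n) : {set 'I_n} := if o is Some z then [set z] else set0.

(** Only evaluations of [f] are counted, so the independence oracles are asked about all subsets in
    advance. *)
Definition queries (S : {set 'I_n}) (y : 'I_n) : seq ('I_q * {set 'I_n}) :=
  [seq (l, A) | l <- enum 'I_q, A <- enum (powerset (h @: (y |: S)))].

(** Names are examined in the order of [enum], which within a window is also their order in
    [schedule]: each [Read] delivers the item about to be examined. Between two names the buffer
    holds the handles of the leader and of [H]. *)
Fixpoint window_alg (i : nat) (S H : {set 'I_n}) (vS : R) (ys : seq 'I_n)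
    (cur : leader) (k : leader -> alg) : alg :=
  if ys is y :: ys' then
    if entrant i (S, H) y (w y) then
      let body :=
        ask_all (queries S y) (fun _ _ => false) (fun ans =>
        try_all h (swaps (fun l A => ans l (h @: A)) S y) (vS, S) (fun b =>
        let cur' := challenge vS cur y b in
        Discard (~: (h @: (pickset (omap fst cur') :|: H)))
          (window_alg i S H vS ys' cur' k))) in
      if (w y).1 == i :> nat then Read body else body
    else window_alg i S H vS ys' cur k
  else k cur.

Fixpoint run_alg (c i : nat) (S H : {set 'I_n}) (vS : R) : alg :=
  if c is c'.+1 then
    window_alg i S H vS (enum 'I_n) None (fun cur =>
      if cur is Some (z, b) then run_alg c' i.+1 b.2 (z |: H) b.1
      else run_alg c' i.+1 S H vS)
  else Output (h @: S).

(** Later values of the solution are by-products of the swaps; only that of the empty set needs an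
    evaluation of its own. *)
Definition main_alg : alg := (Eval set0 (fun r => run_alg m'.+1 0 set0 set0 r)).

(* Coins count even for elements that have not been picked, so that this is only an
   upper bound on the number of candidates of window [i]. *)
Definition load (i : nat) : nat :=
  #|[set y | ((w y).1 == i :> nat) || ((w y).2 (inord i) == ord0)]|.

Variables (T : finType) (M : 'I_q -> matroid T) (f : {set T} -> R).
Variable s : {ffun 'I_n -> T}.
Variables (cap K : nat).

Let u : {ffun 'I_n -> T} := [ffun y => s (h y)].
Hypothesis u_bij : bijective u.

Local Notation v := (fun A : {set 'I_n} => f (u @: A)).
Local Notation M' := (fun l => pullback u_bij (M l)).
Local Notation ind := (oracle M').
Local Notation spec := (run_spec M f s cap).

Hypothesis size_swaps_K : forall S y, S \in feasible M' -> (size (swaps ind S y) <= K)%N.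

Lemma items_handle (A : {set 'I_n}) : items s (h @: A) = u @: A.
Proof.
by rewrite /items -imset_comp; apply: eq_imset => y; rewrite ffunE.
Qed.

Lemma indep_answer_handle l (A : {set 'I_n}) : indep_answer M s l (h @: A) = ind l A.
Proof. by rewrite oracle_pullback /indep_answer items_handle. Qed.

Definition leading (S : {set 'I_n}) (o : option 'I_n) : leader :=
  omap (fun z => (z, best_swap v ind S z)) o.

Lemma leadingK S o : omap fst (leading S o) = o.
Proof. by case: o. Qed.

Lemma challenge_leading S o y :
  challenge (v S) (leading S o) y (best_swap v ind S y) =
  leading S (contend v ind S o y).
Proof. by case: o => [z|] /=; case: ifP. Qed.

Lemma run_spec_body t (S H : {set 'I_n}) o y e X k :
  S \subset H -> S \in feasible M' ->
  spec t (h @: (pickset (contend v ind S o y) :|: H)) e X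
    (k (leading S (contend v ind S o y))) ->
  spec t (h @: (y |: (pickset o :|: H))) (e + K) X
   (ask_all (queries S y) (fun _ _ => false) (fun ans =>
        try_all h (swaps (fun l A => ans l (h @: A)) S y) (v S, S) (fun b =>
        let cur' := challenge (v S) (leading S o) y b in
        Discard (~: (h @: (pickset (omap fst cur') :|: H))) (k cur')))).
Proof.
move=> SH fS Hk.
have sub (A : {set 'I_n}) : A \subset y |: S -> h @: A \subset h @: (y |: (pickset o :|: H)).
  move=> Ay; apply: imsetS; apply: subset_trans Ay _.
  by rewrite setUS // (subset_trans SH) // subsetUr.
apply: run_spec_ask.
  by move=> _ /allpairsP[[l A] /= [_ + ->]]; rewrite mem_enum inE => /subset_trans-> //; exact: sub.
move=> ans ansE.
have -> : swaps (fun l A => ans l (h @: A)) S y = swaps ind S y.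
  apply: eq_swaps => l A Ay; rewrite ansE ?indep_answer_handle //.
  by apply: allpairs_f; rewrite mem_enum // inE imsetS.
set L := swaps _ _ _.
suff [h1 h2 h3] : spec t (h @: (y |: (pickset o :|: H))) (e + size L) X
   (try_all h L (v S, S) (fun b =>
        let cur' := challenge (v S) (leading S o) y b in
        Discard (~: (h @: (pickset (omap fst cur') :|: H))) (k cur'))).
  by split=> //; apply: leq_trans h2 _; rewrite leq_add2l size_swaps_K.
apply: run_spec_try => [A /swaps_sub /sub //|].
have -> : foldl (fun (b : R * {set 'I_n}) (A : {set 'I_n}) => update_best b (f (items s (h @: A))) A) (v S, S) L =
    best_swap v ind S y.
  rewrite /best_swap -/L; elim: L (v S, S) => //= A L IH b.
  by rewrite IH items_handle.
rewrite /= challenge_leading leadingK.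
have E : h @: (y |: (pickset o :|: H)) :\: ~: (h @: (pickset (contend v ind S o y) :|: H))
   = h @: (pickset (contend v ind S o y) :|: H).
  rewrite setDE setCK; apply/setIidPr/imsetS.
  rewrite subUset setUA subsetUr andbT.
  apply: subset_trans (subsetUl _ _).
  case: (o) => [z|] /=; case: ifP => _ /=.
  - exact: subsetUl.
  - exact: subsetUr.
  - exact: subsetUl.
  - exact: sub0set.
by case: Hk => h1 h2 h3; split=> //=; rewrite E.
Qed.

(** Invariant: the rest of the schedule consists of the names in [ys] that arrive in window [i],
    followed by [r]. The bound [#|H|.+2] leaves room for the leader and the item being read. *)
Lemma run_spec_window t i (S H : {set 'I_n}) ys o r e X k :
  S \subset H -> S \in feasible M' -> (#|H|.+2 <= cap)%N ->
  drop t (schedule w) = [seq y <- ys | (w y).1 == i :> nat] ++ r ->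
  let o' := foldl (contend v ind S) o [seq y <- ys | entrant i (S, H) y (w y)] in
  (forall t', drop t' (schedule w) = r ->
     spec t' (h @: (pickset o' :|: H)) e X (k (leading S o'))) ->
  spec t (h @: (pickset o :|: H))
    (e + K * size [seq y <- ys | entrant i (S, H) y (w y)]) X
    (window_alg i S H (v S) ys (leading S o) k).
Proof.
move=> SH fS capH; elim: ys t o => [|y ys IH] t o /= dr Hk.
  by rewrite muln0 addn0; exact: Hk.
move: dr Hk; have [ya|yna] := boolP ((w y).1 == i :> nat).
  have -> /= : entrant i (S, H) y (w y) by rewrite /entrant ya.
  move=> dr Hk; have [tn tE dr'] := drop_schedule dr.
  have := run_spec_body (k := fun cur => window_alg i S H (v S) ys cur k) SH fS
    (IH _ _ dr' Hk).
  rewrite -addnA -mulnSr => -[h1 h2 h3].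
  have BE : h @: (pickset o :|: H) :|: [set i0 : 'I_n | val i0 == t] =
      h @: (y |: (pickset o :|: H)).
    by rewrite tE setUC imsetU1.
  split=> //=; rewrite BE; split=> //.
  apply: leq_trans capH; rewrite (leq_trans (leq_imset_card _ _)) //.
  rewrite cardsU1 -add1n; apply: leq_add; first by case: (_ \notin _).
  rewrite (leq_trans (leq_card_setU _ _)) // -add1n leq_add2r.
  by case: (o) => [z|] /=; rewrite ?cards1 ?cards0.
have [en|_] /= := boolP (entrant _ _ _ _) => dr Hk; last exact: IH.
(* A candidate that does not arrive in this window was picked before, so its item is already in the
   buffer. *)
have yH : y \in H by move: en; rewrite /entrant (negPf yna) => /andP[].
have := run_spec_body (k := fun cur => window_alg i S H (v S) ys cur k) SH fS
    (IH _ _ dr Hk).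
rewrite -addnA -mulnSr (setUidPr _) //.
by rewrite sub1set inE yH orbT.
Qed.

Fixpoint run_from (c i : nat) (st : state n) : state n :=
  if c is c'.+1 then run_from c' i.+1 (advance v ind (winner v ind i st w) st) else st.

Lemma run_from_history c i :
  run_from c i (state_of v ind (history v ind w i)) =
  state_of v ind (history v ind w (c + i)).
Proof. by elim: c i => //= c IH i; rewrite (IH i.+1) addnS. Qed.

(** At most one name joins [H] in each window, so [#|st.2| + c < cap] persists and leaves two free
    places as long as a window remains. *)
Lemma run_spec_run c i t (st : state n) :
  st.1 \subset st.2 -> st.1 \in feasible M' -> (#|st.2| + c < cap)%N ->
  drop t (schedule w) = flatten [seq arrivals w j | j <- iota i c] ->
  spec t (h @: st.2) (K * \sum_(j <- iota i c) load j)
    (h @: (run_from c i st).1) (run_alg c i st.1 st.2 (v st.1)).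
Proof.
elim: c i t st => [|c IH] i t [S H] /= SH fS capH dr.
  split=> //=; rewrite imsetS //; split=> //.
  by rewrite items_handle; move: fS; rewrite feasible_pullback.
have capH2 : (#|H|.+2 <= cap)%N by move: capH => /=; lia.
rewrite big_cons mulnDr addnC.
set k := fun cur : leader => _.
pose o' := winner v ind i (S, H) w.
have := @run_spec_window t i S H (enum 'I_n) None _
  (K * \sum_(j <- iota i.+1 c) load j) (h @: (run_from c i.+1 (advance v ind o' (S, H))).1)
  k SH fS capH2 dr.
rewrite /= -/(winner v ind i (S, H) w) -/o' set0U => /(_ _)[|h1 h2 h3].
  move=> t' dr'.
  case: o' => [z|] /=; last first.
    rewrite set0U; apply: (IH i.+1 t' (S, H)) => //=.
    by apply: leq_ltn_trans capH; rewrite leq_add2l.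
  have [b1 _ _ b4] := best_swapP v ind S z.
  have := IH i.+1 t' ((best_swap v ind S z).2, z |: H).
  rewrite /= -b1; apply=> //.
  - case: b4 => [->|/swaps_sub /subset_trans->//].
      by rewrite (subset_trans SH) ?subsetUr.
    exact: setUS.
  - exact: best_swap_feasible.
  - apply: leq_ltn_trans capH; rewrite addnS -addSn leq_add2r.
    by rewrite cardsU1; case: (_ \notin _).
split=> //; apply: leq_trans h2 _; rewrite leq_add2l leq_mul2l; apply/orP; right.
rewrite /load cardE size_filter -size_filter; apply: uniq_leq_size.
  by rewrite filter_uniq ?enum_uniq.
move=> y; rewrite mem_filter !mem_enum !inE andbT /entrant /=.
by case/orP=> [->//|/andP[_ ->]]; rewrite orbT.
Qed.

Lemma run_spec_main : (m'.+1 < cap)%N ->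
  spec 0 set0 (K * \sum_(j <- iota 0 m'.+1) load j).+1
    (h @: (state_of v ind (history v ind w m'.+1)).1) main_alg.
Proof.
move=> capm.
have E : run_from m'.+1 0 (set0, set0) = state_of v ind (history v ind w m'.+1).
  by have := run_from_history m'.+1 0; rewrite addn0.
have E0 : items s set0 = u @: set0 by rewrite /items !imset0.
have [||||] := @run_spec_run m'.+1 0 0 (set0, set0).
- by [].
- exact: set0_feasible.
- by rewrite cards0.
- by rewrite drop0.
rewrite E [(_, _).2]/= imset0 => h1 h2 h3.
by split; rewrite /main_alg; [split; rewrite ?sub0set ?E0 | rewrite [evals _ _ _ _]/= E0 | rewrite [LHS]/= E0].
Qed.

End Algorithm.

(** * The number of coins that come up *)

Section Coins.
Variables (n m' : nat).
Implicit Types w : {ffun 'I_n -> label m'}.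

Definition coins w : nat := \sum_(y < n) \sum_(j < m'.+1) ((w y).2 j == ord0).

(** Overwriting the coin by an arbitrary value sends pairs of such a labelling and a value
    injectively to labellings. *)
Lemma card_coin (y : 'I_n) (j : 'I_m'.+1) :
  (m'.+1 * #|[set w : {ffun 'I_n -> label m'} | (w y).2 j == ord0]|
   <= #|{ffun 'I_n -> label m'}|)%N.
Proof.
set E := [set w | _].
pose flip (wc : {ffun 'I_n -> label m'} * 'I_m'.+1) : {ffun 'I_n -> label m'} :=
  [ffun x => if x == y then
     ((wc.1 x).1, [ffun k => if k == j then wc.2 else (wc.1 x).2 k]) else wc.1 x].
rewrite mulnC -[X in (_ * X)%N]card_ord -[#|'I__|]cardsT -cardsX.
rewrite -(card_in_imset (f := flip)) ?max_card //.
move=> [w c] [w' c'] /setXP[/= wE _] /setXP[/= w'E _] /ffunP eqf.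
have := eqf y; rewrite !ffunE eqxx /= => -[e1 /ffunP e2].
have cc : c = c' by have := e2 j; rewrite !ffunE eqxx.
congr (_, _) => //; apply/ffunP => x.
have [->|xy] := eqVneq x y; last by have := eqf x; rewrite !ffunE (negPf xy).
rewrite (surjective_pairing (w y)) (surjective_pairing (w' y)) e1; congr (_, _).
apply/ffunP => k; have [->|kj] := eqVneq k j; last first.
  by have := e2 k; rewrite !ffunE (negPf kj).
by move: wE w'E; rewrite !inE => /eqP-> /eqP->.
Qed.

Lemma sum_coins : (\sum_w coins w <= n * #|{ffun 'I_n -> label m'}|)%N.
Proof.
rewrite -(@leq_pmul2l m'.+1) // /coins exchange_big /=.
rewrite (eq_bigr (fun y : 'I_n =>
  \sum_(j < m'.+1) #|[set w : {ffun 'I_n -> label m'} | (w y).2 j == ord0]|)%N).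
  rewrite big_distrr /= mulnA [(m'.+1 * n)%N]mulnC -mulnA.
  rewrite -[X in (_ <= X * _)%N](card_ord n) -sum_nat_const; apply: leq_sum => y _.
  rewrite big_distrr /= -[X in (_ <= X * _)%N](card_ord m'.+1) -sum_nat_const.
  by apply: leq_sum => j _; exact: card_coin.
move=> y _; rewrite exchange_big /=; apply: eq_bigr => j _.
by rewrite -sum1_card [RHS]big_mkcond /=; apply: eq_bigr => w _; rewrite inE; case: eqP.
Qed.

Definition crowded (K : nat) w : bool := (K * n < coins w)%N.

(** Markov's inequality, the mean of [coins] being at most [n]. When [n = 0] there are no coins. *)
Lemma card_crowded K :
  (K * #|[set w : {ffun 'I_n -> label m'} | crowded K w]| <= #|{ffun 'I_n -> label m'}|)%N.
Proof.
case: (posnP n) => [n0|n0].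
  rewrite (_ : [set w | _] = set0) ?cards0 ?muln0 //.
  apply/setP => w; rewrite !inE /crowded /coins big1 // => y _.
  by have := ltn_ord y; rewrite {2}n0.
rewrite -(leq_pmul2l n0) mulnA [(n * K)%N]mulnC; apply: leq_trans sum_coins.
rewrite mulnC -sum_nat_const big_mkcond /=; apply: leq_sum => w _.
by rewrite inE /crowded; case: ifP => // /ltnW.
Qed.

(** The term [n] counts the arrivals, since every name arrives in exactly one window. *)
Lemma sum_load w : (\sum_(j <- iota 0 m'.+1) load w j <= n + coins w)%N.
Proof.
have -> : iota 0 m'.+1 = index_iota 0 m'.+1 by rewrite /index_iota subn0.
rewrite big_mkord.
apply: (@leq_trans (\sum_(j < m'.+1) \sum_(y < n)
    (((w y).1 == j) + ((w y).2 j == ord0))%N)%N).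
  apply: leq_sum => j _; rewrite /load -sum1_card big_mkcond /=.
  apply: leq_sum => y _; rewrite inE inord_val.
  by rewrite val_eqE; do 2 case: (_ == _).
rewrite exchange_big /coins /= -[X in (_ <= X + _)%N](card_ord n) -sum1_card.
rewrite -big_split /=; apply: leq_sum => y _.
rewrite big_split /= leq_add2r (bigD1 (w y).1) //= eqxx big1 // => j /negPf.
by rewrite eq_sym => ->.
Qed.

End Coins.

(* Whatever the labels, the naming of the items is uniformly random. *)
Lemma sum_arrival_orders (R : realType) (n : nat) (T : finType) (h : 'I_n -> 'I_n)
    (F : {ffun 'I_n -> T} -> R) : injective h ->
  \sum_(s in arrival_orders n T) F [ffun y => s (h y)] =
  \sum_(u in arrival_orders n T) F u.
Proof.
move=> hI; have [g hK gK] := injF_bij hI.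
rewrite [RHS](reindex (fun s : {ffun 'I_n -> T} => [ffun y => s (h y)])) /=.
  apply: eq_bigl => s; rewrite !inE; apply/injectiveP/injectiveP => sI x y.
    by rewrite !ffunE => /sI /hI.
  by have := sI (g x) (g y); rewrite !ffunE !gK => H /H /(congr1 h); rewrite !gK.
exists (fun s : {ffun 'I_n -> T} => [ffun y => s (g y)]) => s _;
  by apply/ffunP => y; rewrite !ffunE ?hK ?gK.
Qed.

(** * Arrival orders and the optimum *)

Lemma arrival_orders_bij (n : nat) (T : finType) (u : {ffun 'I_n -> T}) :
  #|T| = n -> u \in arrival_orders n T -> bijective u.
Proof.
by rewrite inE => cT /injectiveP uI; apply: inj_card_bij => //; rewrite cT card_ord.
Qed.

Lemma card_arrival_orders_gt0 (n : nat) (T : finType) :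
  #|T| = n -> (0 < #|arrival_orders n T|)%N.
Proof.
move=> cT; apply/card_gt0P.
exists [ffun i => enum_val (cast_ord (esym cT) i)]; rewrite inE.
by apply/injectiveP => i j; rewrite !ffunE => /enum_val_inj /cast_ord_inj.
Qed.

Section Optimum.
Variables (R : realType) (T : finType) (q : nat) (M : 'I_q -> matroid T).
Variable f : {set T} -> R.

Lemma le_OPT S : S \in feasible M -> f S <= OPT M f.
Proof. by move=> fS; exact: le_bigmax_cond. Qed.

Lemma OPT_feasible : nonnegative f -> exists2 S, S \in feasible M & OPT M f = f S.
Proof.
move=> f0; have f0' := set0_feasible M.
pose S := [arg max_(S > set0 in feasible M) f S]%O.
have [fS max] : S \in feasible M /\ forall A, A \in feasible M -> f A <= f S.
  by rewrite /S; case: arg_maxP => // A fA H; split=> // B; exact: H.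
exists S => //; apply/eqP; rewrite eq_le le_OPT // andbT.
by apply: bigmax_le.
Qed.

End Optimum.

(** * The complete algorithm and its guarantees *)

Section StreamingAlgorithm.
Variables (R : realType) (alpha K : nat).

(** [label m'] has [m'.+1] windows, hence the predecessor. *)
Definition windows (k : nat) : nat := (alpha * k).-1.

Definition default_label (n m' : nat) : {ffun 'I_n -> label m'} :=
  [ffun=> (ord0, [ffun=> ord0])].

Definition stream (n k q : nat) : stream_alg R n q :=
  if k == 0%N then Output set0
  else draw (default_label n (windows k)) (fun w =>
    if crowded K w then Output set0 else main_alg R q w).

Variables (p n k q : nat) (T : finType) (M : 'I_q -> matroid T).
Variable f : {set T} -> R.
Hypotheses (alpha_ge : (2 * p.+1 <= alpha)%N) (cardT : #|T| = n)
  (matchoidM : is_matchoid p M) (sizeM : max_feasible_size M = k)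
  (f_ge0 : nonnegative f) (f_mono : monotone f) (f_sub : submodular f).

Let alpha_gt0 : (0 < alpha)%N.
Proof. exact: leq_trans alpha_ge. Qed.

Local Notation m' := (windows k).
Local Notation names := {ffun 'I_n -> label m'}.

(* [ind] is the oracle of the matroids pulled back along [u], spelled out so as not
   to depend on a proof that [u] is bijective. *)
Definition value (u : {ffun 'I_n -> T}) (w : names) : R :=
  let ind l (A : {set 'I_n}) :=
    A :&: u @^-1: ground (M l) \in [set B : {set 'I_n} | u @: B \in indep (M l)] in
  let v := fun A : {set 'I_n} => f (u @: A) in
  f (u @: (state_of v ind (history v ind w m'.+1)).1).

Lemma run_spec_stream (s : {ffun 'I_n -> T}) (w : names) :
  (0 < k)%N -> s \in arrival_orders n T ->
  let P := main_alg R q w in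
  [/\ legal M f s (alpha.+1 * k) 0 set0 P,
      (evals M f s P <= ((n + coins w) * max_rk M ^ p).+1)%N
    & draw_expectation M f s P = value [ffun y => s (handle w y)] w].
Proof.
move=> k0 sA P.
have uA : [ffun y => s (handle w y)] \in arrival_orders n T.
  move: sA; rewrite !inE => /injectiveP sI; apply/injectiveP => x y.
  by rewrite !ffunE => /sI /handle_inj.
have u_bij := arrival_orders_bij cardT uA.
have sizeK S y : S \in feasible (fun l => pullback u_bij (M l)) ->
    (size (swaps (oracle (fun l => pullback u_bij (M l))) S y) <= max_rk M ^ p)%N.
  move=> fS; rewrite -(max_rk_pullback u_bij M).
  apply: size_swaps_le => //; first exact: matchoid_pullback.
  apply: (max_rk_gt0 (matchoid_pullback u_bij matchoidM)).
  by rewrite max_feasible_size_pullback sizeM.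
(* The buffer needs one place more than there are windows; [k > 0] provides it. *)
have capm : (m'.+1 < alpha.+1 * k)%N.
  by rewrite prednK ?muln_gt0 ?alpha_gt0 // mulSn -[X in (X < _)%N]add0n ltn_add2r.
have [h1 h2 h3] := run_spec_main f sizeK capm.
split=> //.
  apply: leq_trans h2 _; rewrite ltnS mulnC leq_mul2r sum_load orbT //.
by rewrite h3 items_handle.
Qed.

Lemma sum_value (u : {ffun 'I_n -> T}) : (0 < k)%N -> u \in arrival_orders n T ->
  #|{: names}|%:R *
    (p.+1%:R^-1 * (1 - (expR 1 ^+ p.+1)^-1 - 2 * p.+1%:R / alpha%:R) * OPT M f) <=
  \sum_w value u w.
Proof.
move=> k0 uA; have u_bij := arrival_orders_bij cardT uA.
have [O fO ->] := OPT_feasible M f_ge0.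
have := process_value (M := fun l => pullback u_bij (M l)) (m' := m')
  (matchoid_pullback u_bij matchoidM) (nonnegative_pullback u f_ge0)
  (monotone_pullback u f_mono) (submodular_pullback u_bij f_sub)
  (O := u @^-1: O) (k := k) (alpha := alpha).
rewrite imset_preim // => H; apply: H => //.
- by rewrite feasible_pullback imset_preim.
- rewrite -(card_imset _ (bij_inj u_bij)) imset_preim // -sizeM.
  exact: (leq_bigmax_cond (P := [in feasible M]) (F := fun A : {set T} => #|A|)).
- by rewrite prednK // muln_gt0 alpha_gt0.
Qed.

Lemma value_le_OPT (u : {ffun 'I_n -> T}) w : u \in arrival_orders n T ->
  value u w <= OPT M f.
Proof.
move=> uA; have u_bij := arrival_orders_bij cardT uA.
apply: le_OPT; rewrite -(feasible_pullback u_bij).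
exact: state_of_feasible.
Qed.

Lemma legal_stream (s : {ffun 'I_n -> T}) : s \in arrival_orders n T ->
  legal M f s (alpha.+1 * k) 0 set0 (stream n k q).
Proof.
move=> sA; have out0 : legal M f s (alpha.+1 * k) 0 set0 (Output set0).
  by split; rewrite ?sub0set // /items imset0; exact: set0_feasible.
rewrite /stream; case: ifPn => // k0; apply: legal_draw => w; case: ifP => // _.
by have [] := run_spec_stream w (etrans (lt0n k) k0) sA.
Qed.

Lemma evals_stream (s : {ffun 'I_n -> T}) : s \in arrival_orders n T ->
  (evals M f s (stream n k q) <= (K + 2) * n * max_rk M ^ p)%N.
Proof.
move=> sA; rewrite /stream; case: ifPn => // k0; apply: evals_draw => w.
case: ifPn => // ncr; have [_ h _] := run_spec_stream w (etrans (lt0n k) k0) sA.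
apply: leq_trans h _; rewrite -leqNgt in ncr.
have r0 : (0 < max_rk M)%N by apply: (max_rk_gt0 matchoidM); rewrite sizeM lt0n.
have n0 : (0 < n)%N.
  rewrite -cardT; move: k0; rewrite -lt0n -sizeM => /leq_trans; apply.
  by apply/bigmax_leqP => S _; exact: max_card.
have rp : (0 < max_rk M ^ p)%N by rewrite expn_gt0 r0.
(* The initial evaluation is absorbed by [n * max_rk M ^ p], which is positive here. *)
apply: (@leq_trans (((n + coins w) * max_rk M ^ p) + n * max_rk M ^ p)).
  by rewrite -addn1 leq_add2l muln_gt0 n0.
rewrite -mulnDl leq_mul2r; apply/orP; right.
by rewrite mulnDl; lia.
Qed.

(** For fixed labels, arrival order and handles compose to a uniformly random naming, so after
    exchanging the sums [sum_value] applies to each naming. A crowded labelling forfeits at most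
    [OPT], and at most a fraction [1 / K] of them is crowded. *)
Lemma expected_value_stream : (0 < K)%N ->
  (p.+1%:R^-1 * (1 - (expR 1 ^+ p.+1)^-1 - 2 * p.+1%:R / alpha%:R) - K%:R^-1) * OPT M f
  <= expected_value M f (stream n k q).
Proof.
move=> K0; rewrite /expected_value.
have c0 := card_arrival_orders_gt0 cardT.
have [k0|k0] := posnP k.
  (* For [k = 0] the optimum is [f set0], which the algorithm attains, and the factor is at most
     1. *)
  have [S fS E] := OPT_feasible M f_ge0.
  have S0 : S = set0.
    apply/eqP; rewrite -cards_eq0 -leqn0 -[X in (_ <= X)%N]k0 -sizeM.
    exact: (leq_bigmax_cond (P := [in feasible M]) (F := fun A : {set T} => #|A|)).
  rewrite /stream k0 /= (eq_bigr (fun=> f set0)); last first.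
    by move=> s _; rewrite /items imset0.
  rewrite sumr_const -[X in _ <= X / _]mulr_natl [leRHS]mulrAC mulfV; last first.
    by rewrite pnatr_eq0 -lt0n.
  rewrite E S0 ler_wpM2r //.
  have P1 : (p.+1%:R^-1 : R) <= 1 by rewrite invf_le1 ?ler1n ?ltr0n.
  have P0 : (0 : R) <= p.+1%:R^-1 by rewrite invr_ge0.
  have e0 : (0 : R) <= (expR 1 ^+ p.+1)^-1 by rewrite invr_ge0 exprn_ge0 ?expR_ge0.
  have a0 : (0 : R) <= 2 * p.+1%:R / alpha%:R by rewrite divr_ge0 ?mulr_ge0.
  have K1 : (0 : R) <= K%:R^-1 by rewrite invr_ge0.
  set x := 1 - _ - _; have x1 : x <= 1 by rewrite /x; lra.
  have : p.+1%:R^-1 * x <= p.+1%:R^-1 * 1 by rewrite ler_wpM2l.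
  by rewrite mulr1 => h; apply: le_trans P1; apply: le_trans h; rewrite gerBl.
have W0 : (0 < #|{: names}|)%N by apply/card_gt0P; exists (default_label n m').
rewrite ler_pdivlMr ?ltr0n //.
pose bad := [set w : names | crowded K w].
have OPT0 : 0 <= OPT M f by have [S _ ->] := OPT_feasible M f_ge0; exact: f_ge0.
have -> : \sum_(s in arrival_orders n T) draw_expectation M f s (stream n k q) =
    (\sum_(s in arrival_orders n T) \sum_(w : names)
      if crowded K w then f set0 else value [ffun y => s (handle w y)] w)
    / #|{: names}|%:R.
  rewrite mulr_suml; apply: eq_bigr => s sA.
  rewrite /stream (negPf (lt0n_neq0 k0)) draw_expectation_draw; congr (_ / _).
  apply: eq_bigr => w _; case: ifP => _ /=; first by rewrite /items imset0.
  by have [] := run_spec_stream w k0 sA.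
rewrite ler_pdivlMr ?ltr0n // exchange_big /=.
apply: (@le_trans _ _ (\sum_(w : names) \sum_(u in arrival_orders n T)
    (value u w - (crowded K w)%:R * OPT M f))); last first.
  apply: ler_sum => w _.
  rewrite -(sum_arrival_orders _ (@handle_inj _ _ w)); apply: ler_sum => s sA.
  case: ifP => _; last by rewrite mul0r subr0.
  rewrite mul1r; apply: le_trans (f_ge0 _); rewrite subr_le0 value_le_OPT //.
  move: sA; rewrite !inE => /injectiveP sI; apply/injectiveP => x y.
  by rewrite !ffunE => /sI /handle_inj.
rewrite exchange_big /=.
have -> : (p.+1%:R^-1 * (1 - (expR 1 ^+ p.+1)^-1 - 2 * p.+1%:R / alpha%:R) - K%:R^-1) *
   OPT M f * #|arrival_orders n T|%:R * #|{: names}|%:R =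
  \sum_(u in arrival_orders n T) (#|{: names}|%:R *
    (p.+1%:R^-1 * (1 - (expR 1 ^+ p.+1)^-1 - 2 * p.+1%:R / alpha%:R) * OPT M f)
    - #|{: names}|%:R * K%:R^-1 * OPT M f).
  by rewrite sumr_const -mulr_natl; ring.
apply: ler_sum => u uA; rewrite sumrB; apply: lerB; first exact: sum_value.
rewrite -mulr_suml ler_wpM2r // ler_pdivlMr ?ltr0n //.
rewrite -natr_sum -natrM ler_nat; apply: leq_trans (card_crowded n m' K).
rewrite mulnC leq_mul2l -sum1_card big_mkcond /= [leqRHS]big_mkcond /=.
by apply/orP; right; apply: leq_sum => w _; rewrite inE; case: crowded.
Qed.

End StreamingAlgorithm.

Theorem theorem5 (R : realType) (p : nat) (hp : (1 <= p)%N)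
    (eps : R) (heps : 0 < eps) :
  exists (eta : nat -> nat) (C_mem : nat) (C_apx C_ev : R)
         (alg : forall n k q : nat, stream_alg R n q),
    (forall k : nat, (eta k <= C_mem * k)%N) /\
    forall (n k q : nat) (T : finType) (M : 'I_q -> matroid T)
           (f : {set T} -> R),
      #|T| = n -> is_matchoid p M -> max_feasible_size M = k ->
      nonnegative f -> monotone f -> submodular f ->
      [/\ forall s : {ffun 'I_n -> T}, s \in arrival_orders n T ->
            legal M f s (eta k) 0 set0 (alg n k q),
          (p.+1%:R)^-1
            * (1 - (expR 1 ^+ p.+1)^-1 - eps - C_apx / k%:R) * OPT M f
            <= expected_value M f (alg n k q)
        & forall s : {ffun 'I_n -> T}, s \in arrival_orders n T ->
            (evals M f s (alg n k q))%:R / n%:R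
            <= C_ev * (p%:R * (max_rk M)%:R + (max_rk M)%:R ^+ p
                       + k%:R ^+ 2 / n%:R)].
Proof.
have P0 : (0 : R) < p.+1%:R by rewrite ltr0n.
(* With [K] and [alpha] above [x], the contraction error [2 * p.+1%:R / alpha%:R] is at most
   [eps / 2], and the loss [1 / K] from crowded labellings is at most [eps / 2] divided by
   [p.+1]. *)
pose x : R := 4 * p.+1%:R / eps.
have x0 : 0 < x by rewrite divr_gt0 // mulr_gt0.
pose K := Num.bound x.
have xK : x < K%:R by apply: archi_boundP; exact: ltW.
have K0 : (0 < K)%N by rewrite -(ltr0n R) (lt_trans x0 xK).
pose alpha := (2 * p.+1 + K)%N.
have alpha_ge : (2 * p.+1 <= alpha)%N by exact: leq_addr.
(* The two errors already fit into [eps], hence [0] for [C_apx]; the factor [K + 2] comes from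
   [evals_stream]. *)
exists (fun k => alpha.+1 * k)%N, alpha.+1, 0, (K + 2)%:R.
exists (fun n k q => stream R alpha K n k q); split=> // n k q T M f cT mM sM f0 fm fs.
split.
- by move=> s; exact: (legal_stream K f alpha_ge cT mM sM).
- have K_gt0 : (0 : R) < K%:R by rewrite ltr0n.
  have xe : x * eps = 4 * p.+1%:R by rewrite /x mulfVK // lt0r_neq0.
  have le4 (y : R) : K%:R <= y -> 4 * p.+1%:R <= eps * y.
    by move=> Ky; rewrite -xe mulrC ler_pM2l // ltW // (lt_le_trans xK Ky).
  have ha : 2 * p.+1%:R / alpha%:R <= eps / 2.
    have aK : K%:R <= alpha%:R :> R by rewrite ler_nat leq_addl.
    rewrite ler_pdivrMr ?(lt_le_trans K_gt0) //.
    by have := le4 _ aK; lra.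
  have hK : K%:R^-1 <= p.+1%:R^-1 * (eps / 2).
    rewrite mulrC ler_pdivlMr // mulrC ler_pdivrMr //.
    by have := le4 _ (lexx _); lra.
  apply: le_trans (expected_value_stream alpha_ge cT mM sM f0 fm fs K0).
  apply: ler_wpM2r; first by have [S _ ->] := OPT_feasible M f0; exact: f0.
  rewrite mul0r subr0; set E := (_ ^+ _)^-1; set y := 2 * _ / _ in ha *.
  have : p.+1%:R^-1 * y <= p.+1%:R^-1 * (eps / 2).
    by rewrite ler_wpM2l // invr_ge0 ltW.
  move: hK; set z := p.+1%:R^-1; lra.
- move=> s sA; have rp : (0 : R) <= (max_rk M)%:R ^+ p by rewrite exprn_ge0.
  have rest : (0 : R) <= p%:R * (max_rk M)%:R + k%:R ^+ 2 / n%:R.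
    by rewrite addr_ge0 ?mulr_ge0 ?invr_ge0 ?exprn_ge0.
  apply: (@le_trans _ _ ((K + 2)%:R * (max_rk M)%:R ^+ p)); last first.
    by rewrite ler_wpM2l //; lra.
  (* For [n = 0] the left-hand side is [0], as division by [0] gives [0]. *)
  have [n0|n0] := posnP n; first by rewrite [in X in _ / X]n0 invr0 mulr0 mulr_ge0.
  rewrite ler_pdivrMr ?ltr0n // -natrX -!natrM ler_nat mulnAC.
  exact: (evals_stream K f alpha_ge cT mM sM).
Qed.
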